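(* Let $V$ be a complex vector space of dimension $2n$ with a symplectic form $\omega$, and let $X\subset\mathbb{P}(V)$ be a legendrian subvariety which is an irreducible normal complete intersection. Then $X$ is a linear subspace of $\mathbb{P}(V)$.
   Context: A linear subspace $W\subset V$ is Lagrangian if it is a maximal subspace with $\omega|_W\equiv 0$ (so $\dim W=n$). For a projective variety $X\subset\mathbb{P}(V)$ let $\hat X\subset V$ be the affine cone over $X$ and $\hat X_0$ the set of smooth points of $\hat X$ other than $0$. $X$ is legendrian if $T_x\hat X_0\subset V$ is Lagrangian for every $x\in\hat X_0$; then $\dim X=n-1$. Complete intersection means that the homogeneous ideal of $X$ is generated by $\operatorname{codim} X=n$ homogeneous polynomials. *)

(* Defs.v *)
From HB Require Import structures.
From mathcomp Require Import all_boot all_order all_algebra.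
From mathcomp Require Import boolp classical_sets.
From mathcomp Require Import reals complex mpoly.

Set Implicit Arguments.
Unset Strict Implicit.
Unset Printing Implicit Defensive.
Import GRing.Theory.

Local Open Scope classical_set_scope.
Local Open Scope ring_scope.

Section VectorFacts.
Context {K : fieldType} {V : vectType K}.

Lemma vspace_of_set (T : set V) :
  T 0 -> (forall a u v, T u -> T v -> T (a *: u + v)) ->
  exists W : {vspace V}, forall v, v \in W <-> T v.
Proof.
move=> T0 Tlin.
pose sub (d : nat) := `[< exists2 W : {vspace V}, \dim W = d &
                          forall v, v \in W -> T v >].
have ex : exists d, sub d.
  exists 0%N; apply/asboolP; exists 0%VS; first by rewrite dimv0.
  by move=> v; rewrite memv0 => /eqP ->.
have bnd d : sub d -> (d <= \dim {:V})%N.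
  by move=> /asboolP [W <- _]; apply/dimvS/subvf.
case: (ex_maxnP ex bnd) => d /asboolP [W dW WT] maxd.
exists W => v; split; first exact: WT.
move=> Tv.
have : (\dim (<[v]> + W)%VS <= \dim W)%N.
  rewrite dW; apply: maxd; apply/asboolP; exists (<[v]> + W)%VS => //.
  move=> _ /memv_addP [_ /vlineP [a ->]] [w Ww ->].
  by apply: Tlin => //; apply: WT.
move=> le; have /eqP eqW : (W == <[v]> + W)%VS.
  by rewrite eqEdim addvSr.
by rewrite eqW (subvP (addvSl _ _)) ?memv_line.
Qed.

End VectorFacts.

(* Irreducibility of Y with respect to the topology whose closed sets are
   given by [closed]. *)
Definition irreducible {T : Type} (closed : set (set T)) (Y : set T) : Prop :=
  Y !=set0 /\
  forall A B : set T, closed A -> closed B ->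
    Y `<=` A `|` B -> Y `<=` A \/ Y `<=` B.

Section AlgebraicGeometry.
Context {K : fieldType} {V : vectType K}.

(* Polynomial functions on V are written in the coordinates of the basis
   [vbasis {:V}]; all the notions below are invariant under linear changes
   of coordinates. *)
Definition vcoord (v : V) : 'I_(\dim {:V}) -> K :=
  fun i => coord (vbasis {:V}) i v.

Local Notation P := {mpoly K[\dim {:V}]}.

Definition vanishing_ideal (Y : set V) : set P :=
  [set p | forall v, Y v -> p.@[vcoord v] = 0].

Definition zariski_closed (Y : set V) : Prop :=
  exists S : set P, Y = [set v | forall p, S p -> p.@[vcoord v] = 0].

Definition differential (p : P) (x v : V) : K :=
  \sum_i (p^`M(i)).@[vcoord x] * vcoord v i.

Definition is_tangent (Y : set V) (x v : V) : Prop :=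
  forall p, vanishing_ideal Y p -> differential p x v = 0.

Definition tangent_space (Y : set V) (x : V) : {vspace V} :=
  xget 0%VS [set W : {vspace V} | forall v, v \in W <-> is_tangent Y x v].

Lemma mem_tangent_space (Y : set V) (x v : V) :
  v \in tangent_space Y x <-> is_tangent Y x v.
Proof.
suff [W hW] : exists W : {vspace V}, forall v, v \in W <-> is_tangent Y x v.
  exact: (xgetPex 0%VS (ex_intro (fun W : {vspace V} =>
    forall v, v \in W <-> is_tangent Y x v) W hW) v).
apply: vspace_of_set.
  move=> p _; rewrite /differential big1 // => i _.
  by rewrite /vcoord linear0 mulr0.
move=> a u w Tu Tw p Ip.
have -> : differential p x (a *: u + w) =
    a * differential p x u + differential p x w.
  rewrite /differential mulr_sumr -big_split; apply: eq_bigr => i _ /=.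
  by rewrite /vcoord linearP mulrDr mulrCA.
by rewrite (Tu _ Ip) (Tw _ Ip) mulr0 addr0.
Qed.

Definition irreducible_chain
    (Y : set V) (x : V) (d : nat) (Z : nat -> set V) : Prop :=
  (forall i, (i <= d)%N ->
     [/\ zariski_closed (Z i), irreducible zariski_closed (Z i),
         Z i x & Z i `<=` Y]) /\
  (forall i, (i < d)%N -> Z i `<` Z i.+1).

(* The Krull dimension of the local ring of Y at x is d. *)
Definition local_dimension (Y : set V) (x : V) (d : nat) : Prop :=
  (exists Z, irreducible_chain Y x d Z) /\
  (forall e Z, irreducible_chain Y x e Z -> (e <= d)%N).

Definition smooth_point (Y : set V) (x : V) : Prop :=
  Y x /\ local_dimension Y x (\dim (tangent_space Y x)).

End AlgebraicGeometry.

Definition projective_space {K : fieldType} (V : vectType K) : Type :=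
  {L : {vspace V} | (\dim L == 1)%N}.

Definition line_of {K : fieldType} {V : vectType K}
    (L : projective_space V) : {vspace V} := val L.

Section ProjectiveGeometry.
Context {K : fieldType} {V : vectType K}.

Local Notation P := {mpoly K[\dim {:V}]}.
Local Notation PV := (projective_space V).

Definition homogeneous (p : P) : Prop := exists d, p \is d.-homog.

Definition projective_closed (X : set PV) : Prop :=
  exists2 S : set P, S `<=` homogeneous &
    X = [set L : PV | forall p v, S p -> v \in line_of L -> p.@[vcoord v] = 0].

Definition affine_cone (X : set PV) : set V :=
  [set v | v = 0 \/ exists2 L, X L & v \in line_of L].

Definition linear_subspace (X : set PV) : Prop :=
  exists W : {vspace V}, X = [set L : PV | (line_of L <= W)%VS].

(* For nonempty X, a polynomial vanishes on the cone iff all its homogeneous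
   components do, so this is the ideal generated by the homogeneous polynomials
   vanishing on X. *)
Definition homogeneous_ideal (X : set PV) : set P :=
  vanishing_ideal (affine_cone X).

Definition ideal_generated_by (m : nat) (f : 'I_m -> P) : set P :=
  [set p | exists a : 'I_m -> P, p = \sum_i a i * f i].

(* c is the codimension of X in P(V). *)
Definition complete_intersection (c : nat) (X : set PV) : Prop :=
  exists f : 'I_c -> P, (forall i, homogeneous (f i)) /\
    homogeneous_ideal X = ideal_generated_by f.

(* Rational functions on P(V) are the elements p / q of Frac K[V] with p and q
   homogeneous of the same degree. *)
Definition is_ratio (f : {fraction P}) (p q : P) : Prop :=
  (exists d, (p \is d.-homog) /\ (q \is d.-homog)) /\
  f = tofrac p / tofrac q.

(* f belongs to the local ring O_{P(V), L}. *)
Definition regular_at (L : PV) (f : {fraction P}) : Prop :=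
  exists p q, is_ratio f p q /\ exists2 v, v \in line_of L & q.@[vcoord v] != 0.

(* For X irreducible, f belongs to the local ring O_{P(V), X} of P(V) at the
   generic point of X, whose residue field is the function field of X. *)
Definition defined_on (X : set PV) (f : {fraction P}) : Prop :=
  exists p q, is_ratio f p q /\ ~ homogeneous_ideal X q.

(* For X irreducible, f belongs to the maximal ideal of O_{P(V), X}, that is,
   f restricts to 0 in the function field of X. *)
Definition zero_on (X : set PV) (f : {fraction P}) : Prop :=
  exists p q, [/\ is_ratio f p q, ~ homogeneous_ideal X q &
                  homogeneous_ideal X p].

(* Normality of an irreducible X: for every point L of X, the local ring
   O_{X, L} is integrally closed in the function field of X. Elements of
   O_{X, L} and of the function field are represented by lifts to O_{P(V), L}
   and O_{P(V), X}, and are equal when the difference of the lifts is zero on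
   X. *)
Definition normal_variety (X : set PV) : Prop :=
  forall (L : PV) (f : {fraction P}), X L -> defined_on X f ->
  (exists2 Q : {poly {fraction P}}, Q \is monic &
     (forall i, regular_at L Q`_i) /\ zero_on X Q.[f]) ->
  exists2 g, regular_at L g & zero_on X (f - g).

End ProjectiveGeometry.

Section Legendrian.
Context {K : fieldType} {V : vectType K}.
Variable omega : V -> V -> K.

Definition isotropic (W : {vspace V}) : Prop :=
  forall u v, u \in W -> v \in W -> omega u v = 0.

Definition lagrangian (W : {vspace V}) : Prop :=
  isotropic W /\
  forall W' : {vspace V}, isotropic W' -> (W <= W')%VS -> W' = W.

Definition legendrian (X : set (projective_space V)) : Prop :=
  forall x : V, smooth_point (affine_cone X) x -> x != 0 ->
    lagrangian (tangent_space (affine_cone X) x).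

End Legendrian.

(* Main.v *)
From HB Require Import structures.
Require Import Defs.
From mathcomp Require Import all_boot all_order all_algebra.
From mathcomp Require Import boolp classical_sets.
From mathcomp Require Import reals complex mpoly.
From mathcomp Require Import ring.

Set Implicit Arguments.
Unset Strict Implicit.
Unset Printing Implicit Defensive.
Import Order.TTheory GRing.Theory Num.Theory.

Local Open Scope ring_scope.

(** Let [f_1, ..., f_n] generate the homogeneous ideal of [X], let [Y] be the cone
    over [X], [A] its coordinate ring and [xi] its generic point.  Each [f_i] has
    a Hamiltonian vector field, the vector [H_i] with
    [omega (H_i, v) = df_i (v)].  At a smooth point of [Y] the tangent space is
    Lagrangian, so it equals its orthogonal, which the [H_i] span.  Smooth points
    are dense ([smooth_dense]); hence the [H_i] form a basis of the tangent space
    at the generic point.  The position vector [xi] is tangent to the cone, by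
    Euler's identity, so [xi = sum_i a_i H_i (xi)] with unique coefficients [a_i]
    in the fraction field of [A] ([euler_hamiltonian]).  Comparing degrees, [a_i]
    has degree [2 - deg f_i].

    Normality enters through [coefficient_local]: every [a_i], brought to
    degree zero by a power of a linear form [l], is regular at the points of [X]
    where [l] is nonzero.
    Otherwise the denominators of some multiple of [a_i] in a local ring form a
    prime [P].  Since the local ring is integrally closed, [P] is, up to factors
    outside it, generated by one element.  Since there are as many equations as
    the codimension, the Jacobian matrix keeps its full rank modulo [P], and
    Cramer's rule provides a denominator of [a_i] that is not in [P].

    A form of degree zero that is regular everywhere on [X] is constant, and one of
    negative degree is zero unless [X] is a point ([global_section_constant],
    [line_linear]).  So only linear and quadratic equations contribute, the latter
    with constant coefficients [c_i].  Let [W] be the span of [Y], cut out by the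
    linear equations.  Pairing [xi = sum_i a_i H_i (xi)] with a vector [y] of [W]
    kills the linear equations and leaves [omega (x, y) = B (x, y)], where [B] is
    the polar form of [sum_i c_i f_i].  As [B] is symmetric and [omega] is
    alternating, [omega] vanishes on [W] ([span_isotropic]).  A tangent space of
    [Y] is contained in [W] and is a maximal isotropic subspace, so it is [W].
    Then all equations are linear and [Y = W].

    The dimension theory behind this is developed for a prime of the polynomial
    ring given as the kernel of a morphism [phi] to a field.  The transcendence
    degree [tdeg phi] drops strictly along inclusions of primes ([tdeg_drop]) and
    can be lowered by one at a time away from any hypersurface ([tdeg_step]),
    which gives the Nullstellensatz and chains of maximal length; it is also the
    dimension of the tangent space at the generic point ([tangent_dim_le],
    [tangent_dim_ge]). *)

(** * Ideals and Hilbert's basis theorem *)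

Section Ideals.
Context {R : comNzRingType}.
Implicit Types (I J : R -> Prop) (s : seq R).

Definition ideal I :=
  [/\ I 0, forall x y, I x -> I y -> I (x + y) & forall a x, I x -> I (a * x)].

(** The smallest ideal containing [s], encoded as an intersection so that a
    membership is proved or used by naming one ideal. *)
Definition ideal_span s : R -> Prop :=
  fun x => forall J, ideal J -> (forall y, y \in s -> J y) -> J x.

Lemma ideal_sum I (T : Type) (r : seq T) (P : pred T) (F : T -> R) :
  ideal I -> (forall i, P i -> I (F i)) -> I (\sum_(i <- r | P i) F i).
Proof. by case=> I0 ID _ IF; elim/big_ind: _ => //; apply: ID. Qed.

Lemma idealB I x y : ideal I -> I x -> I y -> I (x - y).
Proof. by case=> _ ID IM Ix Iy; rewrite -mulN1r; apply: ID => //; apply: IM. Qed.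

Lemma ideal_ideal_span s : ideal (ideal_span s).
Proof.
split=> [J [] //|x y sx sy J iJ sJ|a x sx J iJ sJ]; case: (iJ) => _ JD JM.
  exact: JD (sx J iJ sJ) (sy J iJ sJ).
exact: JM (sx J iJ sJ).
Qed.

Lemma mem_ideal_span s x : x \in s -> ideal_span s x.
Proof. by move=> xs J _; apply. Qed.

Lemma ideal_span_sub I s x :
  ideal I -> (forall y, y \in s -> I y) -> ideal_span s x -> I x.
Proof. by move=> iI sI; apply. Qed.

Lemma sub_ideal_span s t x :
  {subset s <= t} -> ideal_span s x -> ideal_span t x.
Proof.
move=> st; apply: ideal_span_sub; first exact: ideal_ideal_span.
by move=> y /st; apply: mem_ideal_span.
Qed.

Lemma ideal_spanP s x :
  ideal_span s x <-> exists c : 'I_(size s) -> R, x = \sum_i c i * s`_i.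
Proof.
split=> [|[c ->]]; last first.
  apply: ideal_sum => [|i _]; first exact: ideal_ideal_span.
  case: (ideal_ideal_span s) => _ _; apply; apply: mem_ideal_span; exact: mem_nth.
pose J y := exists c : 'I_(size s) -> R, y = \sum_i c i * s`_i.
move=> sx; apply: (sx J).
  split=> [|x1 x2 [c1 ->] [c2 ->]|a x1 [c ->]].
  - by exists (fun=> 0); rewrite big1 // => i _; rewrite mul0r.
  - exists (fun i => c1 i + c2 i); rewrite -big_split /=.
    by apply: eq_bigr => i _; rewrite mulrDl.
  - by exists (fun i => a * c i); rewrite mulr_sumr; apply: eq_bigr => i _; rewrite mulrA.
move=> y /(nthP 0) [i ilt <-]; exists (fun j => (val j == i)%:R).
rewrite (bigD1 (Ordinal ilt)) //= eqxx mul1r big1 ?addr0 // => j.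
by rewrite -val_eqE /= => /negPf ->; rewrite mul0r.
Qed.

Definition noetherian :=
  forall I, ideal I ->
  exists2 s, forall y, y \in s -> I y & forall x, I x -> ideal_span s x.

(** Were there no maximal member, dependent choice would give a strictly
    increasing sequence of ideals, whose union is not finitely generated. *)
Lemma noetherian_max (Phi : (R -> Prop) -> Prop) I0 :
  noetherian -> (forall I, Phi I -> ideal I) -> Phi I0 ->
  exists I, [/\ Phi I, forall x, I0 x -> I x & forall J, Phi J ->
    (forall x, I x -> J x) -> forall x, J x -> I x].
Proof.
move=> noe PhiI Phi0; apply: contrapT => nomax.
pose T := {I : R -> Prop | Phi I /\ forall x, I0 x -> I x}.
have next (t : T) : exists t' : T, (forall x, sval t x -> sval t' x) /\
    exists x, sval t' x /\ ~ sval t x.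
  case: t => I [PI I0I] /=; apply: contrapT => no.
  apply: nomax; exists I; split=> // J PJ IJ x Jx; apply: contrapT => nIx.
  apply: no; have hJ : Phi J /\ forall x, I0 x -> J x by split=> // y /I0I /IJ.
  by exists (exist _ J hJ); split=> //; exists x.
have [f fP] := choice next.
pose t0 : T := exist _ I0 (conj Phi0 (fun x => id)).
pose u k := iter k f t0.
have umon k l x : (k <= l)%N -> sval (u k) x -> sval (u l) x.
  elim: l => [|l IH]; first by rewrite leqn0 => /eqP ->.
  rewrite leq_eqVlt => /predU1P [-> //|]; rewrite ltnS => /IH ul /ul.
  by case: (fP (u l)) => + _; apply.
have iU : ideal (fun x => exists k, sval (u k) x).
  have iu k : ideal (sval (u k)) by apply: PhiI; case: (svalP (u k)).
  split.
  - by exists 0%N; case: (iu 0%N).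
  - move=> x y [k uk] [l ul]; exists (maxn k l).
    case: (iu (maxn k l)) => _ + _; apply.
      by apply: umon uk; apply: leq_maxl.
    by apply: umon ul; apply: leq_maxr.
  - by move=> a x [k uk]; exists k; case: (iu k) => _ _; apply.
have [s sU Us] := noe _ iU.
have [k sk] : exists k, forall y, y \in s -> sval (u k) y.
  elim: s sU {Us} => [|a s IH] sU; first by exists 0%N.
  have [k ks] : exists k, forall y, y \in s -> sval (u k) y.
    by apply: IH => y ys; apply: sU; rewrite inE ys orbT.
  have [l la] := sU a (mem_head _ _).
  exists (maxn k l) => y; rewrite inE => /predU1P [->|/ks].
    by apply: umon la; apply: leq_maxr.
  by apply: umon; apply: leq_maxl.
have [_ [x [ux nux]]] := fP (u k); apply: nux.
apply: (ideal_span_sub _ sk); first by apply: PhiI; case: (svalP (u k)).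
by apply: Us; exists k.+1.
Qed.

End Ideals.
Arguments noetherian R : clear implicits.

Lemma noetherian_field (K : fieldType) : noetherian K.
Proof.
move=> I [I0 ID IM]; case: (pselect (exists x, I x /\ x != 0)) => [[x [Ix x0]]|nI].
  exists [:: x] => [y|y _]; first by rewrite inE => /eqP ->.
  have -> : y = (y / x) * x by rewrite mulfVK.
  by case: (ideal_ideal_span [:: x]) => _ _; apply; apply: mem_ideal_span; rewrite mem_head.
exists [::] => // x Ix; have -> : x = 0.
  by apply: contrapT => /eqP x0; apply: nI; exists x.
by case: (@ideal_ideal_span K [::]).
Qed.

Lemma noetherian_surj (R S : comNzRingType) (f : {rmorphism R -> S}) :
  (forall y, exists x, f x = y) -> noetherian R -> noetherian S.
Proof.
move=> fsurj noeR I [I0 ID IM].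
have iI : ideal (fun x => I (f x)).
  split=> [|x y Ix Iy|a x Ix]; first by rewrite rmorph0.
    by rewrite rmorphD; apply: ID.
  by rewrite rmorphM; apply: IM.
have [s sI Is] := noeR _ iI.
exists (map f s) => [y /mapP [x xs ->]|y Iy]; first exact: sI.
have [x fx] := fsurj y; move: Iy; rewrite -fx => /Is sx J [J0 JD JM] sJ.
apply: (ideal_span_sub (I := fun x => J (f x)) _ _ sx) => [|z zs].
  split=> [|u v Ju Jv|a u Ju]; first by rewrite rmorph0.
    by rewrite rmorphD; apply: JD.
  by rewrite rmorphM; apply: JM.
by apply/sJ/map_f.
Qed.

(** Hilbert's basis theorem.  The elements of degree less than [m] of an ideal
    [I] are generated by induction on [m], through the ideal of the
    coefficients of degree [m].  Beyond the degrees of elements whose leading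
    coefficients generate all leading coefficients, any element of [I] can be
    lowered. *)
Lemma noetherian_poly (R : comNzRingType) : noetherian R -> noetherian {poly R}.
Proof.
move=> noe I iI; case: (iI) => I0 ID IM.
(* Finitely many generators of an ideal of coefficients lift simultaneously. *)
have lift (L : R -> Prop) (Q : R -> {poly R} -> Prop) : ideal L ->
    (forall a, L a -> exists p, Q a p) ->
    exists2 t : seq (R * {poly R}), (forall u, u \in t -> Q u.1 u.2) &
      forall a, L a -> ideal_span (map fst t) a.
  move=> iL LQ; have [s sL Ls] := noe _ iL.
  have [t tQ ts] : exists2 t : seq (R * {poly R}),
      (forall u, u \in t -> Q u.1 u.2) & map fst t = s.
    elim: s sL {Ls} => [|a s IH] sL; first by exists [::].
    have [|t tQ ts] := IH; first by move=> y ys; apply: sL; rewrite inE ys orbT.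
    have [p Qp] := LQ a (sL a (mem_head _ _)).
    exists ((a, p) :: t) => [u|/=]; last by rewrite ts.
    by rewrite inE => /predU1P [->|/tQ].
  by exists t => //; rewrite ts.
have low m : exists2 s, forall y, y \in s -> I y &
    forall p, I p -> (size p <= m)%N -> ideal_span s p.
  elim: m => [|m [s sI Is]].
    exists [::] => // p _; rewrite size_poly_leq0 => /eqP ->.
    by case: (@ideal_ideal_span {poly R} [::]).
  pose L a := exists p : {poly R}, [/\ I p, (size p <= m.+1)%N & p`_m = a].
  have iL : ideal L.
    split=> [|a b [p [Ip sp <-]] [q [Iq sq <-]]|a b [p [Ip sp <-]]].
    - by exists 0; rewrite coef0 size_poly0.
    - exists (p + q); split; rewrite ?coefD //; first exact: ID.
      by rewrite (leq_trans (size_polyD _ _)) // geq_max sp.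
    - exists (a%:P * p); split; rewrite ?coefCM //; first exact: IM.
      by rewrite mul_polyC (leq_trans (size_scale_leq _ _)).
  have [t tQ Lt] := lift L _ iL (fun a La => La).
  exists (map snd t ++ s) => [y|p Ip sp].
    by rewrite mem_cat => /orP [/mapP [u /tQ [+ _ _] ->] //|/sI].
  pose J a := exists q, [/\ ideal_span (map snd t ++ s) q, I q,
      (size q <= m.+1)%N & q`_m = a].
  have iJ : ideal J.
    have [J0 JD JM] := ideal_ideal_span (map snd t ++ s).
    split=> [|a b [p1 [sp1 Ip1 zp <-]] [q [sq Iq zq <-]]|a b [p1 [sp1 Ip1 zp <-]]].
    + by exists 0; rewrite coef0 size_poly0.
    + exists (p1 + q); split; rewrite ?coefD //; [exact: JD|exact: ID|].
      by rewrite (leq_trans (size_polyD _ _)) // geq_max zp.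
    + exists (a%:P * p1); split; rewrite ?coefCM //; [exact: JM|exact: IM|].
      by rewrite mul_polyC (leq_trans (size_scale_leq _ _)).
  have tJ a : a \in map fst t -> J a.
    move=> /mapP [u ut ->]; have [Iu su eu] := tQ u ut.
    exists u.2; split=> //; apply: mem_ideal_span.
    by rewrite mem_cat map_f.
  have Lp : L p`_m by exists p.
  have [q [sq Iq zq eq]] := Lt _ Lp J iJ tJ.
  have -> : p = (p - q) + q by rewrite subrK.
  have [J0 JD JM] := ideal_ideal_span (map snd t ++ s); apply: JD => //.
  apply: (@sub_ideal_span _ s); first by move=> y ys; rewrite mem_cat ys orbT.
  apply: Is; first exact: idealB.
  apply/leq_sizeP => j; rewrite leq_eqVlt => /predU1P [<-|lt].
    by rewrite coefB eq subrr.
  by rewrite coefB !nth_default ?subrr // (leq_trans _ lt).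
pose L a := exists p m, [/\ I p, (size p <= m.+1)%N & p`_m = a].
have iL : ideal L.
  split=> [|a b [p [m [Ip sp <-]]] [q [l [Iq sq <-]]]|a b [p [m [Ip sp <-]]]].
  - by exists 0, 0%N; rewrite coef0 size_poly0.
  - exists ('X^l * p + 'X^m * q), (m + l)%N; split.
    + by apply: ID; apply: IM.
    + rewrite (leq_trans (size_polyD _ _)) // geq_max !(leq_trans (size_polyMleq _ _)) //.
        by rewrite size_polyXn addSn /= (leq_trans (leq_add (leqnn _) sq)) // addnS.
      by rewrite size_polyXn addSn /= (leq_trans (leq_add (leqnn _) sp)) // addnS addnC.
    + by rewrite coefD !coefXnM ltnNge leq_addl /= addnK ltnNge leq_addr /= addKn.
  - exists (a%:P * p), m; split; rewrite ?coefCM //; first exact: IM.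
    by rewrite mul_polyC (leq_trans (size_scale_leq _ _)).
have [t tQ Lt] := lift L (fun a p => exists m, [/\ I p, (size p <= m.+1)%N & p`_m = a]) iL
  (fun a La => La).
have [D DP] : exists D, forall u, u \in t -> (size u.2 <= D)%N.
  exists (\max_(u <- t) size u.2)%N => u ut.
  exact: (@leq_bigmax_seq _ t xpredT (fun u : R * {poly R} => size u.2)).
have [s sI Is] := low D.
exists (map snd t ++ s) => [y|p Ip].
  by rewrite mem_cat => /orP [/mapP [u /tQ [m [+ _ _]] ->] //|/sI].
move: {2}(size p) (leqnn (size p)) => z; elim: z p Ip => [|z IH] p Ip.
  rewrite size_poly_leq0 => /eqP ->.
  by case: (ideal_ideal_span (map snd t ++ s)).
have [zD|Dz] := leqP z.+1 D => zp.
  apply: (@sub_ideal_span _ s); first by move=> y ys; rewrite mem_cat ys orbT.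
  by apply: Is => //; apply: leq_trans zD.
pose J a := exists q, [/\ ideal_span (map snd t ++ s) q, I q,
      (size q <= z.+1)%N & q`_z = a].
have iJ : ideal J.
  have [J0 JD JM] := ideal_ideal_span (map snd t ++ s).
  split=> [|a b [p1 [sp1 Ip1 zp1 <-]] [q [sq Iq zq <-]]|a b [p1 [sp1 Ip1 zp1 <-]]].
  + by exists 0; rewrite coef0 size_poly0.
  + exists (p1 + q); split; rewrite ?coefD //; [exact: JD|exact: ID|].
    by rewrite (leq_trans (size_polyD _ _)) // geq_max zp1.
  + exists (a%:P * p1); split; rewrite ?coefCM //; [exact: JM|exact: IM|].
    by rewrite mul_polyC (leq_trans (size_scale_leq _ _)).
have tJ a : a \in map fst t -> J a.
  move=> /mapP [u ut ->]; have [m [Iu su eu]] := tQ u ut.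
  have [J0 JD JM] := ideal_ideal_span (map snd t ++ s).
  have st : ideal_span (map snd t ++ s) u.2.
    by apply: mem_ideal_span; rewrite mem_cat map_f.
  have [mz|zm] := leqP m z.
    exists ('X^(z - m) * u.2); split; [exact: JM|exact: IM| |].
      rewrite (leq_trans (size_polyMleq _ _)) // size_polyXn addSn /=.
      by rewrite (leq_trans (leq_add (leqnn _) su)) // addnS subnK.
    by rewrite coefXnM ltnNge leq_subr /= subKn.
  exists 0; rewrite size_poly0 coef0 -eu nth_default //.
  exact: leq_trans (DP _ ut) (ltnW (leq_trans Dz zm)).
have Lp : L p`_z by exists p, z.
have [q [sq Iq zq eq]] := Lt _ Lp J iJ tJ.
have -> : p = (p - q) + q by rewrite subrK.
have [J0 JD JM] := ideal_ideal_span (map snd t ++ s); apply: JD => //.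
apply: IH; first exact: idealB.
apply/leq_sizeP => j; rewrite leq_eqVlt => /predU1P [<-|lt].
  by rewrite coefB eq subrr.
by rewrite coefB !nth_default ?subrr // (leq_trans _ lt).
Qed.

Section MPolyGeneral.
Context {K : fieldType} {N : nat}.
Local Notation S := {mpoly K[N]}.

Lemma mpoly_ring_ind (P : S -> Prop) :
  (forall c, P c%:MP) -> (forall i, P 'X_i) ->
  (forall p q, P p -> P q -> P (p + q)) ->
  (forall p q, P p -> P q -> P (p * q)) -> forall p, P p.
Proof.
move=> PC PX PD PM; elim/mpolyind => [|c m p _ _ IH]; first by rewrite -mpolyC0.
apply: PD => //; rewrite -mul_mpolyC; apply: (PM) => //; rewrite mpolyXE_id.
have P1 : P 1 by rewrite -mpolyC1.
apply: (big_ind P P1 PM) => i _; elim: (m i) => [|k IHk]; first by rewrite expr0.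
by rewrite exprS; apply: PM.
Qed.

Lemma rmorph_mpoly_eq (A : nzRingType) (f g : {rmorphism S -> A}) :
  (forall c, f c%:MP = g c%:MP) -> (forall i, f 'X_i = g 'X_i) -> f =1 g.
Proof.
move=> fgC fgX; apply: mpoly_ring_ind => // p q; rewrite ?(rmorphD, rmorphM) => -> -> //.
Qed.

End MPolyGeneral.

Lemma noetherian_mpoly (K : fieldType) (N : nat) : noetherian {mpoly K[N]}.
Proof.
elim: N => [|N IH].
  apply: (@noetherian_surj K _ (@mpolyC 0 K) _ (@noetherian_field K)) => p.
  by exists (p@_0%MM); exact: esym (nvar0_mpolyC p).
pose f : {poly {mpoly K[N]}} -> {mpoly K[N.+1]} :=
  horner_eval 'X_ord_max \o map_poly (@mwiden N K).
apply: (@noetherian_surj _ _ f _ (@noetherian_poly _ IH)).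
apply: mpoly_ring_ind => [c|i|p q [a <-] [b <-]|p q [a <-] [b <-]].
- by exists (c%:MP)%:P; rewrite /f /= map_polyC /= /horner_eval hornerC mwidenC.
- case: (unliftP ord_max i) => [j|] ->.
    exists ('X_j)%:P; rewrite /f /= map_polyC /= /horner_eval hornerC mwidenX.
    rewrite mnmwiden1; congr 'X_ _; apply/val_inj.
    by rewrite /= /bump leqNgt ltn_ord.
  by exists 'X; rewrite /f /= map_polyX /horner_eval hornerX.
- by exists (a + b); rewrite /f !rmorphD.
- by exists (a * b); rewrite /f !rmorphM.
Qed.

(** * Residue fields of primes *)

Definition prime_ideal {R : comNzRingType} (P : R -> Prop) :=
  [/\ ideal P, ~ P 1 & forall x y, P (x * y) -> P x \/ P y].

Lemma fractionP (D : idomainType) (z : {fraction D}) :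
  exists x y : D, y != 0 /\ z = tofrac x / tofrac y.
Proof.
rewrite -[z]reprK; set r := repr z; have d0 := denom_ratioP r.
exists (frac r).1, (frac r).2; split=> //.
apply: (canRL (mulfK _)); first by rewrite tofrac_eq0.
unlock FracField.tofrac; rewrite -[_ * _]FracField.pi_mul.
apply/eqmodP; rewrite /= FracField.equivfE /FracField.mulf.
by rewrite !numden_Ratio ?mulr1 ?oner_eq0 // mulrC.
Qed.

(** The quotient of a ring by a prime ideal is made into an integral domain;
    its units and inverses are chosen classically. *)
Section PrimeQuotient.
Local Open Scope quotient_scope.
Variables (R : comNzRingType) (I : prime_idealr R).
Local Notation Q := {ideal_quot I}.

Definition quot_unit : {pred Q} := fun x => `[< exists y : Q, y * x = 1 >].
Definition quot_inv (x : Q) : Q :=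
  if x \in quot_unit then xget 0 (fun y : Q => y * x = 1) else x.

Lemma quot_mulV : {in quot_unit, left_inverse 1 quot_inv *%R}.
Proof.
move=> x xu; rewrite /quot_inv xu; case: xgetP => // no.
by case/asboolP: xu => y /no.
Qed.
Lemma quot_unitP (x y : Q) : y * x = 1 -> quot_unit x.
Proof. by move=> yx; apply/asboolP; exists y. Qed.
Lemma quot_inv_out : {in [predC quot_unit], quot_inv =1 id}.
Proof. by move=> x; rewrite inE /quot_inv => /negPf ->. Qed.

HB.instance Definition _ :=
  GRing.ComNzRing_hasMulInverse.Build Q quot_mulV quot_unitP quot_inv_out.
HB.instance Definition _ :=
  GRing.ComUnitRing_isIntegral.Build Q (@Quotient.rquot_IdomainAxiom R I).

Lemma quot_fractions :
  exists (F : fieldType) (phi : {rmorphism R -> F}),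
    (forall x, phi x = 0 <-> x \in I) /\
    (forall z, exists x y, phi y != 0 /\ z = phi x / phi y).
Proof.
pose phi : R -> {fraction Q} := @tofrac Q \o \pi_Q.
have phi0 x : (phi x == 0) = (x \in I).
  by rewrite /phi /= tofrac_eq0 -[0](rmorph0 \pi_Q) -Quotient.idealrBE subr0.
exists {fraction Q}, phi; split.
  by move=> x; rewrite -phi0; split=> /eqP.
move=> z; have [x [y [y0 ->]]] := fractionP z.
exists (repr x), (repr y); rewrite /phi /= !reprK; split=> //.
by rewrite tofrac_eq0.
Qed.

End PrimeQuotient.

Section ResidueField.
Context {R : comNzRingType}.

Definition prime_pred (P : R -> Prop) & prime_ideal P : R -> bool :=
  fun x : R => `[< P x >].

Section Pred.
Context (P : R -> Prop) (primeP : prime_ideal P).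
Local Notation S := (prime_pred primeP).

Lemma prime_pred_ideal : idealr_closed S.
Proof.
have [[P0 PD PM] P1 _] := primeP; split; first exact/asboolP.
  by apply/asboolP.
by move=> a x y /asboolP Px /asboolP Py; apply/asboolP/PD => //; apply: PM.
Qed.

Lemma prime_pred_prime : prime_idealr_closed S.
Proof.
have [_ _ PM] := primeP; move=> x y /asboolP /PM [Px|Py]; apply/orP.
  by left; apply/asboolP.
by right; apply/asboolP.
Qed.

HB.instance Definition _ := isIdealr.Build R S prime_pred_ideal.
HB.instance Definition _ := isPrimeIdealrClosed.Build R S prime_pred_prime.
End Pred.

(** Primes are handled through their residue fields: the images of the variables
    under [phi] are the coordinates of a generic point of the variety of [P]. *)
Lemma residue_field (P : R -> Prop) : prime_ideal P ->
  exists (F : fieldType) (phi : {rmorphism R -> F}),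
    (forall x, phi x = 0 <-> P x) /\
    (forall z, exists x y, phi y != 0 /\ z = phi x / phi y).
Proof.
move=> primeP.
have [F [phi [phi0 phiF]]] := @quot_fractions R (prime_pred primeP).
exists F, phi; split=> // x; rewrite phi0; split=> [/asboolP //|Px].
exact/asboolP.
Qed.

(** Krull's separation lemma: an ideal maximal among those that miss a
    multiplicative set is prime. *)
Lemma prime_avoiding (J M : R -> Prop) :
  noetherian R -> ideal J -> M 1 -> (forall x y, M x -> M y -> M (x * y)) ->
  (forall x, J x -> ~ M x) ->
  exists P, [/\ prime_ideal P, forall x, J x -> P x & forall x, P x -> ~ M x].
Proof.
move=> noe iJ M1 MM JM.
pose Phi (I : R -> Prop) := ideal I /\ forall x, I x -> ~ M x.
have [|P [[iP PM] JP Pmax]] := noetherian_max (Phi := Phi) noe _ (conj iJ JM).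
  by move=> I [].
exists P; split=> //; split=> //; first by move=> /PM.
move=> x y Pxy; have [P0 PD PMl] := iP.
pose I a z := exists b p, P p /\ z = b * a + p.
have iI a : ideal (I a).
  split=> [|u v [b [p [Pp ->]]] [c [q [Pq ->]]]|c u [b [p [Pp ->]]]].
  - by exists 0, 0; rewrite mul0r addr0.
  - by exists (b + c), (p + q); split; [exact: PD|rewrite mulrDl addrACA].
  - by exists (c * b), (c * p); split; [exact: PMl|rewrite mulrDr mulrA].
have PI a z : P z -> I a z by exists 0, z; rewrite mul0r add0r.
have Ia a : I a a by exists 1, 0; rewrite mul1r addr0.
have meets a : ~ P a -> exists2 z, I a z & M z.
  move=> nPa; apply: contrapT => no; apply: nPa.
  apply: (Pmax (I a)) => //; last exact: PI.
  by split=> // z Iz Mz; apply: no; exists z.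
apply: contrapT => /not_orP [/meets [z [b [p [Pp ->]]] Mz] /meets [w [c [q [Pq ->]]] Mw]].
apply: (PM _ _ (MM _ _ Mz Mw)).
have -> : (b * x + p) * (c * y + q) = (b * c) * (x * y) + (c * y * p + (b * x + p) * q).
  by rewrite mulrDr mulrDl mulrACA -addrA; congr (_ + (_ + _)); rewrite mulrC.
by apply: (PD); [|apply: PD]; apply: PMl.
Qed.

End ResidueField.

(** * Transcendence degree and the Nullstellensatz *)

Lemma closed_field_root (K : closedFieldType) (F : fieldType)
    (f : {rmorphism K -> F}) (r : {poly K}) z :
  r != 0 -> root (map_poly f r) z -> exists c, z = f c.
Proof.
move=> r0; have [rs ->] := closed_field_poly_normal r.
rewrite map_polyZ rootZ ?fmorph_eq0 ?lead_coef_eq0 //.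
have -> : map_poly f (\prod_(a <- rs) ('X - a%:P)) =
    \prod_(a <- map f rs) ('X - a%:P).
  rewrite rmorph_prod big_map; apply: eq_bigr => a _.
  by rewrite rmorphB /= map_polyX map_polyC.
by rewrite root_prod_XsubC => /mapP [c _ ->]; exists c.
Qed.

Section Algebraic.
Context {A : comNzRingType} {F : fieldType} (f : {rmorphism A -> F}).

(** The leading coefficient times an algebraic element is integral: multiply the
    equation by a power of its leading coefficient. *)
Lemma algebraic_multiple (q : {poly A}) (x : F) :
  map_poly f q != 0 -> root (map_poly f q) x ->
  exists c, f c != 0 /\ integralOver f (f c * x).
Proof.
move=> q0 qx; set p := map_poly f q in q0 qx.
have sp : (1 < size p)%N by apply: root_size_gt1 qx.
have [m sm] : exists m, size p = m.+2 by case: (size p) sp => [|[|m]] //; exists m.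
exists q`_m.+1; have lc : f q`_m.+1 = lead_coef p.
  by rewrite lead_coefE sm /p coef_map.
split; first by rewrite lc lead_coef_eq0.
pose r := \poly_(i < m.+2) (if i == m.+1 then 1 else q`_i * q`_m.+1 ^+ (m - i)).
have sr : size r = m.+2 by rewrite size_poly_eq // eqxx oner_eq0.
exists r; first by rewrite monicE lead_coefE sr coef_poly ltnSn eqxx.
rewrite /root (@horner_coef_wide _ m.+2); last first.
  by rewrite -sr; apply: size_poly.
apply/eqP; transitivity (f q`_m.+1 ^+ m * p.[x]); last first.
  by rewrite (eqP qx) mulr0.
rewrite horner_coef sm mulr_sumr; apply: eq_bigr => i _.
rewrite coef_map /= coef_poly ltn_ord exprMn /p coef_map /=.
have [-> | ne] := eqVneq (val i) m.+1.
  by rewrite rmorph1 mul1r mulrA -exprSr.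
have im : (i <= m)%N by have := ltn_ord i; rewrite ltnS leq_eqVlt (negPf ne).
rewrite rmorphM rmorphXn /= [RHS]mulrCA -!mulrA; congr (_ * _).
by rewrite mulrA -exprD subnK.
Qed.

(** Once the equation of [z] is divided by the largest possible power of the
    variable, its constant term is a nonzero multiple of [z]. *)
Lemma algebraic_divides_constant (p : {poly A}) (z : F) :
  map_poly f p != 0 -> root (map_poly f p) z -> z != 0 ->
  exists w b, f b != 0 /\ z * (map_poly f w).[z] = f b.
Proof.
move=> + + z0; elim/poly_ind: p => [|p c IH]; first by rewrite rmorph0 eqxx.
rewrite rmorphD rmorphM /= map_polyX map_polyC /= => p0.
rewrite /root hornerMXaddC; have [fc|fc] := eqVneq (f c) 0.
  rewrite fc addr0 mulf_eq0 (negPf z0) orbF => pz; apply: IH => //.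
  by apply: contraNneq p0 => ->; rewrite mul0r fc add0r.
rewrite addr_eq0 => /eqP e; exists p, (- c).
by rewrite rmorphN oppr_eq0; split=> //; rewrite mulrC e.
Qed.

(** Multiply the monic equation of [z] by a power of [y], which turns the powers
    of [z] into powers of [s] times powers of [y]. *)
Lemma integral_quotient (y s : A) (z : F) :
  integralOver f z -> f s = f y * z -> exists n t, f (s ^+ n + y * t) = 0.
Proof.
case=> p pmon pz sy; have [n sp] : exists n, size p = n.+1.
  by exists (size p).-1; rewrite prednK // size_poly_gt0 monic_neq0.
have pn : p`_n = 1 by have /eqP := pmon; rewrite lead_coefE sp.
exists n, (\sum_(i < n) p`_i * s ^+ i * y ^+ (n.-1 - i)).
have /eqP := pz; rewrite (@horner_coef_wide _ n.+1); last by rewrite -sp size_poly.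
rewrite big_ord_recr coef_map /= pn rmorph1 mul1r => /(congr1 ( *%R (f y ^+ n))).
rewrite mulr0 mulrDr -exprMn -sy addrC => <-.
rewrite rmorphD rmorphXn rmorphM rmorph_sum /= !mulr_sumr; congr (_ + _).
apply: eq_bigr => i _; rewrite coef_map !rmorphM !rmorphXn /= sy exprMn.
have -> : f y ^+ n = f y * (f y ^+ i * f y ^+ (n.-1 - i)).
  rewrite -exprD -exprS subnKC; first by case: (n) i => // -[].
  by case: (n) i => [[]|n' i] //; rewrite -ltnS.
by ring.
Qed.

End Algebraic.

Section Transcendence.
Import mathcomp.boot.finset.
Context {K : numClosedFieldType} {N : nat}.
Local Notation S := {mpoly K[N]}.
Implicit Types (B : {set 'I_N}) (p q u : S).

Definition restr_tuple B : N.-tuple S :=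
  [tuple if i \in B then 'X_i else 0 | i < N].

(** [restr B] substitutes [0] for the variables outside [B], so that its image
    is the polynomial ring in the variables of [B]. *)
Local Notation restr B := (comp_mpoly (restr_tuple B)).

Lemma restrX B i : restr B 'X_i = if i \in B then 'X_i else 0.
Proof. by rewrite comp_mpolyXU -tnth_nth tnth_mktuple. Qed.

Lemma restr_restr (A B : {set _}) p : restr A (restr B p) = restr (A :&: B) p.
Proof.
move: p; apply: (@rmorph_mpoly_eq _ _ _ (restr A \o restr B) (restr (A :&: B))).
  by move=> c /=; rewrite !comp_mpolyC.
move=> i /=; rewrite !restrX inE andbC; case: ifP => _; first by rewrite restrX.
by rewrite rmorph0.
Qed.

Lemma restr_sub (A B : {set _}) p : A \subset B -> restr B (restr A p) = restr A p.
Proof. by move=> /setIidPr AB; rewrite restr_restr AB. Qed.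

Lemma restr0 p : restr set0 p = (p.@[fun=> 0])%:MP.
Proof.
move: p; apply: (@rmorph_mpoly_eq _ _ _ (restr set0) (@mpolyC N K \o meval (fun=> 0))).
  by move=> c /=; rewrite comp_mpolyC mevalC.
by move=> i /=; rewrite restrX inE mevalXU mpolyC0.
Qed.

Lemma restrT p : restr setT p = p.
Proof.
move: p; apply: (@rmorph_mpoly_eq _ _ _ (restr setT) idfun).
  by move=> c /=; rewrite comp_mpolyC.
by move=> i /=; rewrite restrX inE.
Qed.

Definition as_poly_coef (i0 i : 'I_N) : {poly S} :=
  if i == i0 then 'X else ('X_i)%:P.

(** The isomorphism that singles out one variable. *)
Local Notation as_poly k := (mmap (polyC \o @mpolyC N K) (as_poly_coef k)).

Lemma as_polyC k c : as_poly k c%:MP = (c%:MP)%:P.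
Proof. by rewrite mmapC. Qed.

Lemma as_polyX k i : as_poly k 'X_i = if i == k then 'X else ('X_i)%:P.
Proof. by rewrite mmapX mmap1U. Qed.

Lemma horner_as_poly k p : (as_poly k p).['X_k] = p.
Proof.
move: p; apply: (@rmorph_mpoly_eq _ _ _ (horner_eval 'X_k \o as_poly k) idfun).
  by move=> c /=; rewrite as_polyC /horner_eval hornerC.
move=> i /=; rewrite as_polyX /horner_eval.
by case: eqP => [->|_]; rewrite ?hornerX ?hornerC.
Qed.

Lemma as_poly_restr k B p :
  map_poly (restr B) (as_poly k (restr (k |: B) p)) = as_poly k (restr (k |: B) p).
Proof.
move: p; apply: (@rmorph_mpoly_eq _ _ _
  (map_poly (restr B) \o (as_poly k \o restr (k |: B))) (as_poly k \o restr (k |: B))).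
  by move=> c /=; rewrite comp_mpolyC as_polyC map_polyC /= comp_mpolyC.
move=> i /=; rewrite restrX 2!inE; have [->|ne] := eqVneq i k => /=.
  by rewrite as_polyX eqxx map_polyX.
case: ifP => iB; last by rewrite !rmorph0.
by rewrite as_polyX (negPf ne) map_polyC /= restrX iB.
Qed.

Lemma as_poly_free k B p :
  k \notin B -> as_poly k (restr B p) = (restr B p)%:P.
Proof.
move=> kB; move: p.
apply: (@rmorph_mpoly_eq _ _ _ (as_poly k \o restr B) (polyC \o restr B)).
  by move=> c /=; rewrite comp_mpolyC as_polyC.
move=> i /=; rewrite restrX; case: ifP => iB; last by rewrite !rmorph0.
by rewrite as_polyX; case: eqP kB iB => [-> /negPf ->|].
Qed.

Lemma exists_nonroot (q : {poly S}) : q != 0 -> exists c : K, q.[c%:MP] != 0.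
Proof.
move=> q0; apply: contrapT => no.
pose rs : seq S := [seq ((i%:R : K)%:MP) | i <- iota 0 (size q)].
have: (size rs < size q)%N.
  apply: max_poly_roots => //.
    apply/allP => _ /mapP [i _ ->]; apply: contrapT => /negP nr.
    by apply: no; exists i%:R.
  rewrite map_inj_uniq ?iota_uniq // => i j /(fmorph_inj (@mpolyC N K)) /eqP.
  by rewrite eqr_nat => /eqP.
by rewrite size_map size_iota ltnn.
Qed.

Section GenericPoint.
Context {F : fieldType} (phi : {rmorphism S -> F}).

Lemma rmorph_mpolyC_eq0 c : (phi c%:MP == 0) = (c == 0).
Proof. by rewrite -[phi _]/((phi \o @mpolyC N K) c) fmorph_eq0. Qed.

(** The coordinates indexed by [B] of the generic point are algebraically
    independent. *)
Definition indep B := forall p, phi (restr B p) = 0 -> restr B p = 0.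

(** The coordinates generate the residue field, so some set of coordinates is a
    transcendence basis, and this maximum is the transcendence degree over [K],
    that is, the dimension of the variety with generic point [phi]. *)
Definition tdeg : nat := \max_(B : {set 'I_N} | `[< indep B >]) #|B|.

Lemma indep0 : indep set0.
Proof.
by move=> p; rewrite restr0 => /eqP; rewrite rmorph_mpolyC_eq0 => /eqP ->.
Qed.

Lemma leq_tdeg B : indep B -> (#|B| <= tdeg)%N.
Proof. by move=> iB; apply: leq_bigmax_cond; apply/asboolP. Qed.

Definition max_indep B :=
  indep B /\ forall k, k \notin B -> ~ indep (k |: B).

Lemma max_indep_tdeg B : indep B -> #|B| = tdeg -> max_indep B.
Proof.
move=> iB eB; split=> // k kB /leq_tdeg; rewrite cardsU1 kB eB.
by rewrite add1n ltnn.
Qed.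

Lemma tdegP : exists2 B, indep B & #|B| = tdeg.
Proof.
have [|B /asboolP iB eB] := @eq_bigmax_cond _ [pred B | `[< indep B >]]
  (fun B : {set 'I_N} => #|B|).
  by apply/card_gt0P; exists set0; rewrite inE; apply/asboolP/indep0.
by exists B => //; rewrite -eB.
Qed.

Section Basis.
Variables (B : {set 'I_N}) (maxB : max_indep B).
Local Notation phiB := (phi \o restr B).

Lemma basis_algebraic k : exists q : {poly S},
  map_poly phiB q != 0 /\ root (map_poly phiB q) (phi 'X_k).
Proof.
have [iB maxiB] := maxB; have [kB|kB] := boolP (k \in B).
  exists ('X - ('X_k)%:P); rewrite rmorphB /= map_polyX map_polyC /=.
  by rewrite polyXsubC_eq0 root_XsubC restrX kB.
have /existsNP [p /not_implyP [pz /eqP p0]] := maxiB k kB.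
exists (as_poly k (restr (k |: B) p)).
have eq : map_poly phiB (as_poly k (restr (k |: B) p)) =
    map_poly phi (as_poly k (restr (k |: B) p)).
  by rewrite map_poly_comp as_poly_restr.
split; last first.
  by rewrite eq /root horner_map horner_as_poly pz eqxx.
apply: contra p0 => /eqP /polyP q0.
rewrite -(horner_as_poly k (restr _ p)) -as_poly_restr.
suff -> : map_poly (restr B) (as_poly k (restr (k |: B) p)) = 0 by rewrite horner0.
apply/polyP => i; rewrite coef0 coef_map; apply: iB.
by have := q0 i; rewrite coef0 coef_map.
Qed.

(** Clearing the leading coefficients of the equations of all coordinates makes
    them, hence everything, integral over the polynomial ring in the variables
    of [B]. *)
Lemma basis_integral : exists d, phiB d != 0 /\
  forall u, exists m, integralOver phiB (phiB d ^+ m * phi u).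
Proof.
have /choice [c cP] k : exists c, phiB c != 0 /\ integralOver phiB (phiB c * phi 'X_k).
  by have [q [q0 qk]] := basis_algebraic k; apply: algebraic_multiple qk.
exists (\prod_k c k); split.
  by rewrite rmorph_prod; apply/prodf_neq0 => k _; case: (cP k).
have intX d m : integralOver phiB (phiB d ^+ m).
  by rewrite -rmorphXn; apply: integral_id.
apply: mpoly_ring_ind => [a|k|p q [m pm] [l ql]|p q [m pm] [l ql]].
- exists 0%N; rewrite expr0 mul1r.
  by rewrite -[phi _]/(phi a%:MP) -(comp_mpolyC a (restr_tuple B)); apply: integral_id.
- exists 1%N; rewrite expr1 (bigD1 k) // mulrC rmorphM mulrA.
  by apply: integral_mul; [rewrite mulrC; case: (cP k)|apply: integral_id].
- exists (m + l)%N; rewrite rmorphD mulrDr exprD; apply: integral_add.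
    by rewrite mulrAC; apply: integral_mul.
  by rewrite -mulrA; apply: integral_mul.
- by exists (m + l)%N; rewrite rmorphM exprD mulrACA; apply: integral_mul.
Qed.

(** The cofactor and the constant come from the integral equation of a multiple
    of [phi u]; the constant plays the role of a norm. *)
Lemma basis_divides u : phi u != 0 ->
  exists u' b, phi (u * u') = phiB b /\ phiB b != 0.
Proof.
move=> u0; have [d [d0 dP]] := basis_integral.
have [m [p pmon pz]] := dP u.
have z0 : phiB d ^+ m * phi u != 0 by rewrite mulf_neq0 ?expf_neq0.
have p0 : map_poly phiB p != 0 by apply/monic_neq0/monic_map.
have [w [b [b0 wb]]] := algebraic_divides_constant p0 pz z0.
exists (restr B d ^+ m * (map_poly (restr B) w).[restr B d ^+ m * u]), b.
have e : phiB d ^+ m * phi u = phi (restr B d ^+ m * u) by rewrite rmorphM rmorphXn.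
split=> //; rewrite -wb e [map_poly (phi \o _) w]map_poly_comp horner_map.
by rewrite -rmorphM mulrA [u * _]mulrC.
Qed.

End Basis.
End GenericPoint.

(** A basis for the smaller variety stays independent on the larger one; were it
    a basis there as well, a nonzero function [g] vanishing on the smaller
    variety would divide a nonzero polynomial in the basis, which would then
    vanish on it. *)
Lemma tdeg_drop (F F' : fieldType) (phi : {rmorphism S -> F})
    (phi' : {rmorphism S -> F'}) g :
  (forall p, phi p = 0 -> phi' p = 0) -> phi' g = 0 -> phi g != 0 ->
  (tdeg phi' < tdeg phi)%N.
Proof.
move=> sub g' g0; have [B iB eB] := tdegP phi'.
have iB' : indep phi B by move=> p /sub /iB.
rewrite ltnNge -eB; apply/negP => le.
have eB' : #|B| = tdeg phi by apply/eqP; rewrite eqn_leq le leq_tdeg.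
have [u [b [eq b0]]] := basis_divides (max_indep_tdeg iB' eB') g0.
move: b0; rewrite /= iB ?rmorph0 ?eqxx //.
transitivity (phi' (restr B b - g * u)).
  by rewrite rmorphB rmorphM g' mul0r subr0.
apply: sub.
by rewrite rmorphB eq subrr.
Qed.

Lemma tdeg_le (F F' : fieldType) (phi : {rmorphism S -> F})
    (phi' : {rmorphism S -> F'}) :
  (forall p, phi p = 0 -> phi' p = 0) -> (tdeg phi' <= tdeg phi)%N.
Proof.
move=> sub; have [B iB <-] := tdegP phi'.
by apply: leq_tdeg => p /sub /iB.
Qed.

(** For a basis [B], [b] in [B] and a general constant [c], no nonzero
    polynomial in [B :\ b], times a power of [h], becomes divisible by
    [x_b - c]: the quotient would be integral up to a power of [d], and its
    equation, multiplied by a power of [x_b - c], would give a polynomial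
    identity that fails at [x_b = c].  A prime that contains [x_b - c] and
    avoids all these elements cuts the dimension by at most one. *)
Lemma tdeg_step (F : fieldType) (phi : {rmorphism S -> F}) h :
  phi h != 0 -> (0 < tdeg phi)%N ->
  exists (F' : fieldType) (phi' : {rmorphism S -> F'}),
    [/\ forall p, phi p = 0 -> phi' p = 0, exists2 g, phi' g = 0 & phi g != 0,
        phi' h != 0 & (tdeg phi <= (tdeg phi').+1)%N].
Proof.
move=> h0; have [B iB eB] := tdegP phi; rewrite -eB => /card_gt0P [b bB].
have maxB := max_indep_tdeg iB eB.
have [d [d0 dP]] := basis_integral maxB.
have [h' [e [he e0]]] := basis_divides maxB h0.
have de0 : as_poly b (restr B (d * e)) != 0.
  apply: contraTneq (mulf_neq0 d0 e0) => z; rewrite negbK -rmorphM /=.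
  by rewrite -(horner_as_poly b (restr B (d * e))) z horner0 rmorph0.
have [c cP] := exists_nonroot de0.
pose ev : {rmorphism S -> S} := horner_eval c%:MP \o as_poly b.
have evB q : ev (restr (B :\ b) q) = restr (B :\ b) q.
  by rewrite /ev /= as_poly_free ?setD11 // /horner_eval hornerC.
have evXc : ev ('X_b - c%:MP) = 0.
  by rewrite rmorphB /ev /= as_polyX eqxx as_polyC /horner_eval hornerX hornerC subrr.
have restrXc : restr B ('X_b - c%:MP) = 'X_b - c%:MP.
  by rewrite rmorphB /= restrX bB comp_mpolyC.
have subB q : restr B (restr (B :\ b) q) = restr (B :\ b) q.
  by rewrite restr_sub // subD1set.
pose J p := exists u, phi p = phi (('X_b - c%:MP) * u).
pose M p := exists q m, restr (B :\ b) q != 0 /\ p = restr (B :\ b) q * h ^+ m.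
have [||x y [q [m [q0 ->]]] [r [l [r0 ->]]]|x [u xu] [q [m [q0 ex]]]|P [pP JP PM]] :=
    @prime_avoiding S J M (@noetherian_mpoly K N).
- split=> [|x y [u xu] [v yv]|a x [u xu]].
  + by exists 0; rewrite mulr0.
  + by exists (u + v); rewrite mulrDr !rmorphD xu yv.
  + by exists (a * u); rewrite mulrCA !(rmorphM _ a) xu.
- by exists 1, 0%N; rewrite !rmorph1 mulr1 oner_neq0.
- exists (q * r), (m + l)%N; rewrite rmorphM mulf_neq0 //; split=> //.
  by rewrite exprD mulrACA.
- (* Multiplying by the cofactor of [h] moves the identity into the
     polynomials in [B]. *)
  pose s := restr (B :\ b) q * restr B e ^+ m.
  pose u' := u * h' ^+ m.
  have sB : restr B s = s by rewrite rmorphM rmorphXn /= subB restr_sub.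
  have su : phi s = phi (('X_b - c%:MP) * u').
    rewrite /u' mulrA [RHS]rmorphM -xu ex -rmorphM -mulrA -exprMn.
    by rewrite !rmorphM !rmorphXn he.
  have [k kz] := dP u'; set y := 'X_b - c%:MP in xu su evXc restrXc *.
  have [|n [t]] := @integral_quotient _ _ (phi \o restr B) y (d ^+ k * s) _ kz.
    by rewrite rmorphM rmorphXn /= sB su restrXc rmorphM mulrCA.
  have e1 : restr B ((d ^+ k * s) ^+ n + y * t) =
      (restr B d ^+ k * s) ^+ n + y * restr B t.
    by rewrite rmorphD rmorphXn rmorphM rmorphXn [X in _ + X]rmorphM /= restrXc sB.
  have e2 : ev ((restr B d ^+ k * s) ^+ n + y * restr B t) =
      (ev (restr B d) ^+ k * (restr (B :\ b) q * ev (restr B e) ^+ m)) ^+ n.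
    rewrite rmorphD [X in _ + X]rmorphM evXc mul0r addr0 rmorphXn; congr (_ ^+ _).
    by rewrite rmorphM rmorphXn rmorphM evB rmorphXn.
  move=> /iB; rewrite e1 => /(congr1 ev); rewrite e2 rmorph0 => /eqP; apply/negP.
  move: cP; rewrite rmorphM -[_.[_]]/(ev (restr B d * restr B e)) rmorphM mulf_eq0 negb_or.
  by case/andP=> nd ne; rewrite expf_neq0 ?mulf_neq0 ?expf_neq0.
have [F' [phi' [ker _]]] := residue_field pP.
have yP : phi' ('X_b - c%:MP) = 0.
  by apply/ker/JP; exists 1; rewrite mulr1.
exists F', phi'; split.
- by move=> p p0; apply/ker/JP; exists 0; rewrite mulr0 rmorph0.
- exists ('X_b - c%:MP) => //; apply/eqP => z.
  have := iB ('X_b - c%:MP); rewrite restrXc => /(_ z) /(congr1 (meval (fun=> c + 1))).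
  rewrite rmorphB /= mevalXU mevalC addrAC subrr add0r rmorph0 => /eqP.
  by rewrite oner_eq0.
- apply/eqP => /ker /PM; apply; exists 1, 1%N.
  by rewrite rmorph1 mul1r expr1 oner_neq0.
- rewrite (cardsD1 b B) bB add1n ltnS; apply: leq_tdeg => q /ker /PM nq.
  apply: contrapT => /eqP q0; apply: nq; exists q, 0%N.
  by rewrite expr0 mulr1.
Qed.

(** The Nullstellensatz: lowering the dimension as long as possible leads to a
    point whose coordinates are algebraic over [K]. *)
Lemma nullstellensatz (F : fieldType) (phi : {rmorphism S -> F}) h :
  phi h != 0 -> exists x : 'I_N -> K,
    (forall p, phi p = 0 -> p.@[x] = 0) /\ h.@[x] != 0.
Proof.
have [d] := ubnP (tdeg phi); elim: d F phi => // d IH F phi le h0.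
have [t0|t0] := posnP (tdeg phi); last first.
  have [F' [phi' [sub [g g' g0] h' _]]] := tdeg_step h0 t0.
  have [|x [xP hx]] := IH F' phi' _ h'.
    by rewrite -ltnS (leq_trans _ le) // ltnS (tdeg_drop sub g' g0).
  by exists x; split=> // p /sub /xP.
have max0 : max_indep phi set0.
  by apply: max_indep_tdeg; [exact: indep0|rewrite cards0 t0].
have /choice [x xP] k : exists c, phi 'X_k = phi c%:MP.
  have [q [q0 qk]] := basis_algebraic max0 k.
  have eq : map_poly (phi \o restr set0) q =
      map_poly (phi \o @mpolyC N K) (map_poly (meval (fun=> 0)) q).
    by rewrite -map_poly_comp; apply: eq_map_poly => u /=; rewrite restr0.
  move: q0 qk; rewrite eq map_poly_eq0 => r0 /(closed_field_root r0) [c ->].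
  by exists c.
have pE p : phi p = phi (p.@[x])%:MP.
  move: p; apply: (@rmorph_mpoly_eq _ _ _ phi (phi \o (@mpolyC N K \o meval x))).
    by move=> c /=; rewrite mevalC.
  by move=> i /=; rewrite mevalXU.
exists x; split=> [p /eqP|]; first by rewrite pE rmorph_mpolyC_eq0 => /eqP.
by apply: contraNneq h0 => z; rewrite pE z mpolyC0 rmorph0.
Qed.

End Transcendence.

Local Notation restr B := (comp_mpoly (restr_tuple B)).
Local Notation as_poly k := (mmap (polyC \o @mpolyC _ _) (as_poly_coef k)).

(** * Derivations and tangent vectors at a generic point *)

(** In characteristic zero the derivative of an equation of least degree is a
    nonzero polynomial of smaller degree, so [x] is not a root of it. *)
Lemma minimal_relation (A : comNzRingType) (F : fieldType) (f : {rmorphism A -> F}) x :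
  [pchar F] =i pred0 ->
  (exists q, map_poly f q != 0 /\ root (map_poly f q) x) ->
  exists q, [/\ root (map_poly f q) x, f (lead_coef q) != 0,
    (map_poly f q)^`().[x] != 0 &
    forall t : {poly A}, (size t < size q)%N -> root (map_poly f t) x -> map_poly f t = 0].
Proof.
move=> charF ex.
pose P n := `[< exists q : {poly A}, [/\ map_poly f q != 0, root (map_poly f q) x & size q = n] >].
have exP : exists n, P n by case: ex => q [q0 qx]; exists (size q); apply/asboolP; exists q.
case: (ex_minnP exP) => n /asboolP [q [q0 qx sq]] minn.
have minq (t : {poly A}) : (size t < size q)%N -> root (map_poly f t) x -> map_poly f t = 0.
  move=> lt tx; apply/eqP; apply: contraTT lt => t0; rewrite -leqNgt sq; apply: minn.
  by apply/asboolP; exists t.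
have sqgt0 : (0 < size q)%N.
  by rewrite size_poly_gt0; apply: contraNneq q0 => ->; rewrite rmorph0.
have [m sm] : exists m, size q = m.+1 by exists (size q).-1; rewrite prednK.
have lq : f (lead_coef q) != 0.
  apply: contra q0 => /eqP lq.
  pose t := \poly_(i < m) q`_i.
  have et : map_poly f q = map_poly f t.
    apply/polyP => i; rewrite !coef_map coef_poly /=; case: ltngtP => // [lt|->].
      by rewrite nth_default ?sm // rmorph0.
    by move: lq; rewrite lead_coefE sm => ->; rewrite rmorph0.
  rewrite et; apply/eqP/minq; last by rewrite -et.
  by rewrite sm ltnS size_poly.
exists q; split=> //.
have sfq : size (map_poly f q) = size q by rewrite size_map_poly_id0.
apply/eqP => d0; have sd : (size q^`() < size q)%N by apply: lt_size_deriv; rewrite -size_poly_gt0.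
have := minq _ sd; rewrite -deriv_map /root d0 eqxx => /(_ isT) /polyP /(_ m.-1).
have m0 : m != 0%N by have := root_size_gt1 q0 qx; rewrite sfq sm ltnS lt0n.
rewrite coef0 coef_deriv prednK ?lt0n // coef_map -mulr_natr => /eqP.
rewrite mulf_eq0 ((pcharf0P F).1 charF) (negPf m0) orbF /=.
by move: lq; rewrite lead_coefE sm => /negPf ->.
Qed.

Section Derivations.
Import mathcomp.boot.finset.
Context {K : numClosedFieldType} {N : nat} {F : fieldType}.
Local Notation S := {mpoly K[N]}.
Variable phi : {rmorphism S -> F}.
Implicit Types (v w : 'I_N -> F) (p q : S) (B C : {set 'I_N}).

(** The derivation over [phi] that sends each variable [x_i] to [v i]. *)
Definition deriv_along v p : F := \sum_i phi p^`M(i) * v i.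

Lemma deriv_along_is_zmod_morphism v : zmod_morphism (deriv_along v).
Proof.
move=> p q; rewrite /deriv_along -sumrB; apply: eq_bigr => i _.
by rewrite mderivB rmorphB mulrBl.
Qed.
HB.instance Definition _ v :=
  GRing.isZmodMorphism.Build S F (deriv_along v) (deriv_along_is_zmod_morphism v).

Lemma deriv_alongM v p q :
  deriv_along v (p * q) = deriv_along v p * phi q + phi p * deriv_along v q.
Proof.
rewrite /deriv_along mulr_suml mulr_sumr -big_split /=; apply: eq_bigr => i _.
by rewrite mderivM rmorphD !rmorphM mulrDl mulrAC -!mulrA.
Qed.

Lemma deriv_alongC v c : deriv_along v c%:MP = 0.
Proof. by rewrite /deriv_along big1 // => i _; rewrite mderivC rmorph0 mul0r. Qed.

Lemma deriv_alongX v i : deriv_along v 'X_i = v i.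
Proof.
rewrite /deriv_along (bigD1 i) //= big1 => [|j ne]; rewrite mderivX mnm1E.
  have -> : (U_(i) - U_(i) = 0 :> 'X_{1..N})%MM by apply/mnmP => j; rewrite mnmBE subnn mnm0E.
  by rewrite eqxx scale1r mpolyX0 rmorph1 mul1r addr0.
by rewrite eq_sym (negPf ne) scale0r rmorph0 mul0r.
Qed.

Lemma deriv_along_eq C v w p :
  (forall i, i \in C -> v i = w i) ->
  deriv_along v (restr C p) = deriv_along w (restr C p).
Proof.
move=> vw; move: p; apply: mpoly_ring_ind => [c|i|p q IHp IHq|p q IHp IHq].
- by rewrite comp_mpolyC !deriv_alongC.
- by rewrite restrX; case: ifP => iC; rewrite ?raddf0 // !deriv_alongX vw.
- by rewrite !raddfD /= IHp IHq.
- by rewrite rmorphM /= !deriv_alongM IHp IHq.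
Qed.

Lemma deriv_along_horner v (t : {poly S}) k :
  deriv_along v t.['X_k] =
  (map_poly (deriv_along v) t).[phi 'X_k] + (map_poly phi t)^`().[phi 'X_k] * v k.
Proof.
elim/poly_ind: t => [|t c IH].
  by rewrite horner0 raddf0 !map_poly0 deriv0 !horner0 mul0r addr0.
rewrite hornerMXaddC raddfD /= deriv_alongM IH deriv_alongX.
have -> : map_poly (deriv_along v) (t * 'X + c%:P) =
    map_poly (deriv_along v) t * 'X + (deriv_along v c)%:P.
  apply/polyP => i; rewrite coef_map !(coefD, coefMX, coefC) coef_map /= raddfD /=.
  by case: (i == 0%N); rewrite ?raddf0.
rewrite rmorphD rmorphM /= map_polyX map_polyC derivD derivC addr0 derivM derivX mulr1.
rewrite !(hornerD, hornerM, hornerX, hornerC) horner_map.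
by ring.
Qed.

Definition tangent v := forall p, phi p = 0 -> deriv_along v p = 0.

Lemma pchar_phi : [pchar F] =i pred0.
Proof.
move=> p; rewrite -[RHS](pchar_num K p).
exact: (fmorph_pchar (phi \o @mpolyC N K)).
Qed.

Section Basis.
Variables (B : {set 'I_N}) (maxB : max_indep phi B).

(** A tangent vector is determined by its components along a basis: the
    equation of minimal degree of another coordinate has a nonzero derivative
    with respect to that coordinate. *)
Lemma tangent_determined v :
  tangent v -> (forall i, i \in B -> v i = 0) -> forall k, v k = 0.
Proof.
move=> tv vB k; have [q [qk _ q' _]] := minimal_relation pchar_phi (basis_algebraic maxB k).
have := tv (map_poly (restr B) q).['X_k].
rewrite -horner_map -map_poly_comp => /(_ (eqP qk)).
rewrite deriv_along_horner -!map_poly_comp.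
have -> : map_poly (deriv_along v \o restr B) q = 0.
  apply/polyP => i; rewrite coef_map_id0 /=; last by rewrite !raddf0.
  rewrite coef0 (@deriv_along_eq _ _ (fun=> 0)) //.
  by rewrite /deriv_along big1 // => j _; rewrite mulr0.
by move/eqP; rewrite horner0 add0r mulf_eq0 (negPf q') => /eqP.
Qed.

(** Conversely any components along a basis extend to a tangent vector, one
    coordinate at a time: the new component is dictated by the equation of
    minimal degree of the coordinate, and pseudo-division by that equation
    shows that all other relations are respected. *)
Lemma tangent_extension w :
  exists v, tangent v /\ forall i, i \in B -> v i = w i.
Proof.
have [iB _] := maxB.
suff [v [vT vB]] : exists v, (forall p, phi (restr setT p) = 0 ->
    deriv_along v (restr setT p) = 0) /\ forall i, i \in B -> v i = w i.
  by exists v; split=> // p; have := vT p; rewrite restrT.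
have -> : [set: 'I_N] = B :|: [set k in enum 'I_N].
  by apply/setP => k; rewrite !inE mem_enum orbT.
elim: (enum 'I_N) => [|k s [v [vC vB]]].
  exists w; split=> // p; set C := B :|: _.
  have -> : C = B by apply/setP => i; rewrite !inE orbF.
  by move=> /iB ->; rewrite raddf0.
have -> : B :|: [set i in k :: s] = k |: (B :|: [set i in s]).
  by apply/setP => i; rewrite !inE orbCA.
set C := B :|: [set i in s] in vC *.
have [kC|kC] := boolP (k \in C).
  exists v; split=> // p; suff -> : k |: C = C by apply: vC.
  by apply/setP => i; rewrite in_setU1; case: eqP => // ->.
have algC : exists q : {poly S}, map_poly (phi \o restr C) q != 0 /\
    root (map_poly (phi \o restr C) q) (phi 'X_k).
  have [q [q0 qk]] := basis_algebraic maxB k; exists (map_poly (restr B) q).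
  suff -> : map_poly (phi \o restr C) (map_poly (restr B) q) = map_poly (phi \o restr B) q by [].
  rewrite -map_poly_comp; apply: eq_map_poly => u /=.
  by rewrite restr_sub // subsetUl.
have [q [qk lq q' minq]] := minimal_relation pchar_phi algC.
set xi := phi 'X_k in qk q' minq.
pose vk := - (map_poly (deriv_along v \o restr C) q).[xi] / (map_poly (phi \o restr C) q)^`().[xi].
pose v' i := if i == k then vk else v i.
have vv' u : deriv_along v' (restr C u) = deriv_along v (restr C u).
  by apply: deriv_along_eq => i iC; rewrite /v' ifN //; apply: contraNneq kC => <-.
have [n nE] : exists n : {rmorphism {poly S} -> S},
    forall t, n t = (map_poly (restr C) t).['X_k].
  by exists (horner_eval 'X_k \o map_poly (restr C)).
have phin t : phi (n t) = (map_poly (phi \o restr C) t).[xi].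
  by rewrite nE -horner_map -map_poly_comp.
have dn t : deriv_along v' (n t) = (map_poly (deriv_along v \o restr C) t).[xi] +
    (map_poly (phi \o restr C) t)^`().[xi] * vk.
  rewrite nE deriv_along_horner -!map_poly_comp /v' eqxx; congr (_.[_] + _).
  by apply: eq_map_poly => u; exact: vv'.
have dq : deriv_along v' (n q) = 0 by rewrite dn /vk mulrCA mulfV // mulr1 subrr.
have key t : phi (n t) = 0 -> deriv_along v' (n t) = 0.
  move=> nt; have q0 : q != 0 by apply: contraNneq lq => ->; rewrite lead_coef0 rmorph0.
  have := Pdiv.Idomain.divp_eq t q; have := Pdiv.Idomain.ltn_modp t q.
  rewrite q0; set a := _ ^+ _; set u := _ %/ _; set r := _ %% _ => sr eq.
  have nq : phi (n q) = 0 by rewrite phin; apply/eqP.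
  have neq : n a%:P * n t = n u * n q + n r by rewrite -!rmorphM -rmorphD -eq mul_polyC.
  have nr : phi (n r) = 0.
    by have := congr1 phi neq; rewrite rmorphD !rmorphM nt nq !mulr0 add0r.
  have r0 : map_poly (phi \o restr C) r = 0.
    by apply: minq => //; rewrite /root -phin nr.
  have dr : deriv_along v' (n r) = 0.
    rewrite dn r0 linear0 horner0 mul0r addr0.
    have -> : map_poly (deriv_along v \o restr C) r = 0; last by rewrite horner0.
    apply/polyP => i; rewrite coef_map_id0 /=; last by rewrite !raddf0.
    by rewrite coef0 vC //; have /polyP /(_ i) := r0; rewrite coef0 coef_map.
  have := congr1 (deriv_along v') neq.
  rewrite raddfD /= !deriv_alongM nt nq dq dr !mulr0 !addr0 add0r => /eqP.
  rewrite mulf_eq0 => /orP [|/eqP //].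
  suff /negPf -> : phi (n a%:P) != 0 by [].
  by rewrite phin map_polyC hornerC /a /= !rmorphXn expf_neq0.
exists v'; split=> [u|i iB'].
  have e : restr (k |: C) u = n (as_poly k (restr (k |: C) u)).
    by rewrite nE as_poly_restr horner_as_poly.
  by rewrite e; apply: key.
rewrite /v'; case: eqP => [ik|_]; last exact: vB.
by move: kC; rewrite -ik inE iB'.
Qed.

End Basis.

Definition basis_proj B : 'M[F]_(N, #|B|) := \matrix_(i, j) (i == enum_val j)%:R.

Lemma mul_basis_proj B m (A : 'M[F]_(m, N)) i j :
  (A *m basis_proj B) i j = A i (enum_val j).
Proof.
rewrite mxE (bigD1 (enum_val j)) //= mxE eqxx mulr1 big1 ?addr0 // => l ne.
by rewrite mxE (negPf ne) mulr0.
Qed.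

(** [M] is a system of linear equations that forces tangency; the projection of
    its solutions to the components along a basis is injective. *)
Lemma tangent_dim_le m (M : 'M[F]_(N, m)) :
  (forall v : 'rV_N, v *m M = 0 -> tangent (v 0)) -> (N <= \rank M + tdeg phi)%N.
Proof.
move=> MT; have [B iB eB] := tdegP phi; have maxB := max_indep_tdeg iB eB.
rewrite -leq_subLR -mxrank_ker -(mxrank_mul_ker _ (basis_proj B)).
suff -> : (kermx M :&: kermx (basis_proj B))%MS = 0.
  by rewrite mxrank0 addn0 -eB rank_leq_col.
apply/eqP/rowV0P => v; rewrite sub_capmx => /andP [/sub_kermxP vM /sub_kermxP vB].
apply/rowP => k; rewrite mxE; apply: (tangent_determined maxB (MT _ vM)) => i iB'.
have := congr1 (fun A : 'rV_#|B| => A 0 (enum_rank_in iB' i)) vB.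
by rewrite mul_basis_proj mxE enum_rankK_in.
Qed.

(** Here the tangent vectors satisfy the equations, and the projection is onto. *)
Lemma tangent_dim_ge m (M : 'M[F]_(N, m)) :
  (forall v, tangent v -> (\row_i v i) *m M = 0) -> (\rank M + tdeg phi <= N)%N.
Proof.
move=> TM; have [B iB eB] := tdegP phi; have maxB := max_indep_tdeg iB eB.
have /choice [v vP] (j : 'I_#|B|) := tangent_extension maxB (fun i => (i == enum_val j)%:R).
pose V := \matrix_(j, i) v j i.
have VM : V *m M = 0.
  apply/row_matrixP => j; rewrite row_mul row0.
  by have [/TM <- _] := vP j; congr (_ *m _); apply/rowP => i; rewrite !mxE.
have VB : V *m basis_proj B = 1%:M.
  apply/matrixP => j l; rewrite mul_basis_proj !mxE.
  have [_ ->] := vP j; last exact: enum_valP.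
  by rewrite (inj_eq enum_val_inj) eq_sym.
have : (V <= kermx M)%MS by apply/sub_kermxP.
move/mxrankS; rewrite mxrank_ker.
have : (\rank (V *m basis_proj B) <= \rank V)%N by apply: mxrankM_maxl.
rewrite VB mxrank1 => le1 le2; rewrite -eB -leq_subRL ?rank_leq_row //.
exact: leq_trans le1 le2.
Qed.

End Derivations.

(** * Varieties, chains and smooth points *)

Lemma clear_denominators (A : comNzRingType) (F : fieldType) (phi : {rmorphism A -> F})
    m n (M : 'M[F]_(m, n)) :
  (forall z, exists x y, phi y != 0 /\ z = phi x / phi y) ->
  exists q (M' : 'M[A]_(m, n)), phi q != 0 /\ map_mx phi M' = phi q *: M.
Proof.
move=> fracs; have /choice [a /choice [b ab]] (ij : 'I_m * 'I_n) :
    exists x y, phi y != 0 /\ M ij.1 ij.2 = phi x / phi y by apply: fracs.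
exists (\prod_ij b ij), (\matrix_(i, j) (a (i, j) * \prod_(kl | kl != (i, j)) b kl)).
split; first by rewrite rmorph_prod; apply/prodf_neq0 => ij _; case: (ab ij).
apply/matrixP => i j; rewrite !mxE [in RHS](bigD1 (i, j)) // !rmorphM.
have [b0 /= ->] := ab (i, j).
by rewrite mulrAC mulrCA mulfV // mulr1.
Qed.

Section Coordinates.
Context {K : fieldType} {V : vectType K}.
Local Notation N := (\dim {:V}).
Local Notation S := {mpoly K[N]}.

Definition of_coord (c : 'I_N -> K) : V := \sum_i c i *: (vbasis {:V})`_i.

Lemma of_coordK c : vcoord (of_coord c) =1 c.
Proof.
move=> i; rewrite /vcoord /of_coord coord_sum_free //.
exact: basis_free (vbasisP _).
Qed.

Lemma meval_of_coord c (p : S) : p.@[vcoord (of_coord c)] = p.@[c].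
Proof. exact/meval_eq/of_coordK. Qed.

Lemma vcoordK (v : V) : of_coord (vcoord v) = v.
Proof. by rewrite /of_coord -coord_vbasis ?memvf. Qed.

Lemma vcoord_inj (u v : V) : vcoord u =1 vcoord v -> u = v.
Proof.
move=> uv; rewrite -(vcoordK u) -(vcoordK v).
by apply: eq_bigr => i _; rewrite uv.
Qed.

Definition crow (v : V) : 'rV[K]_N := \row_i vcoord v i.

Lemma crow_is_linear : linear crow.
Proof. by move=> a u v; apply/rowP => i; rewrite !mxE /vcoord linearP. Qed.
HB.instance Definition _ := GRing.isLinear.Build K V 'rV[K]_N _ crow crow_is_linear.

Definition of_row (u : 'rV[K]_N) : V := of_coord (u 0).

Lemma of_rowK : cancel of_row crow.
Proof. by move=> u; apply/rowP => i; rewrite mxE of_coordK. Qed.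

Lemma crowK : cancel crow of_row.
Proof.
by move=> v; apply: vcoord_inj => i; rewrite of_coordK mxE.
Qed.

Lemma dim_kernel m (M : 'M[K]_(N, m)) (W : {vspace V}) :
  (forall v, v \in W <-> crow v *m M = 0) -> (\dim W + \rank M)%N = N.
Proof.
move=> WM; pose B := \matrix_(i < \dim W) crow (vbasis W)`_i.
have rowB u : u *m B = crow (\sum_i u 0 i *: (vbasis W)`_i).
  rewrite linear_sum mulmx_sum_row; apply: eq_bigr => i _ /=.
  by rewrite linearZ rowK.
have freeB : row_free B.
  apply: inj_row_free => u; rewrite rowB => /(congr1 of_row); rewrite crowK.
  rewrite -[in RHS](linear0 crow) crowK => u0; apply/rowP => i; rewrite mxE.
  by have /freeP /(_ (u 0) u0 i) := basis_free (vbasisP W).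
have BM : (B == kermx M)%MS.
  apply/andP; split.
    apply/row_subP => i; rewrite rowK; apply/sub_kermxP/WM.
    by apply: vbasis_mem; rewrite mem_nth // size_tuple.
  apply/row_subP => i; set u := row i _.
  have uM : u *m M = 0 by apply/sub_kermxP; rewrite row_sub.
  have uW : of_row u \in W by apply/WM; rewrite of_rowK.
  rewrite -(of_rowK u) (coord_vbasis uW).
  set c := fun i => coord (vbasis W) i (of_row u).
  have -> : \sum_(j < \dim W) coord (vbasis W) j (of_row u) *: (vbasis W)`_j =
     \sum_(j < \dim W) (\row_l c l) 0 j *: (vbasis W)`_j.
    by apply: eq_bigr => j _; rewrite mxE.
  by rewrite -rowB submxMl.
have := eqmx_rank BM; rewrite mxrank_ker => e.
by rewrite -{1}(eqP freeB) e subnK // rank_leq_row.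
Qed.

Lemma zariski_closedE (Y : set V) (v : V) : zariski_closed Y ->
  (Y v <-> forall p, vanishing_ideal Y p -> p.@[vcoord v] = 0).
Proof.
case=> I eY; split=> [Yv p|vY]; first by apply.
by rewrite eY => p Ip; apply: vY => w; rewrite eY; apply.
Qed.

Lemma ideal_vanishing (Y : set V) : ideal (vanishing_ideal Y).
Proof.
split=> [v _|p q Ip Iq v Yv|a p Ip v Yv]; first by rewrite rmorph0.
  by rewrite rmorphD /= Ip // Iq // addr0.
by rewrite rmorphM /= Ip // mulr0.
Qed.

Lemma irreducible_prime (Y : set V) :
  irreducible zariski_closed Y -> prime_ideal (vanishing_ideal Y).
Proof.
case=> [[y Yy] irr]; split; first exact: ideal_vanishing.
  by move/(_ y Yy)/eqP; rewrite rmorph1 oner_eq0.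
move=> p q pq; pose Z (r : S) : set V := fun v : V => r.@[vcoord v] = 0.
have clZ r : zariski_closed (Z r).
  exists (eq^~ r); apply/seteqP; split=> v /= vr => [_ ->|]; first exact: vr.
  exact: vr.
have [|Yp|Yq] := irr _ _ (clZ p) (clZ q).
- move=> v Yv; have /eqP := pq v Yv; rewrite rmorphM mulf_eq0.
  by case/orP => /eqP; [left|right].
- by left.
- by right.
Qed.

End Coordinates.

Section Zeros.
Context {K : numClosedFieldType} {V : vectType K}.
Local Notation N := (\dim {:V}).
Local Notation S := {mpoly K[N]}.

(** The variety whose generic point is [phi]. *)
Definition zeros (F : fieldType) (phi : {rmorphism S -> F}) : set V :=
  fun v => forall p, phi p = 0 -> p.@[vcoord v] = 0.

Lemma zeros_closed (F : fieldType) (phi : {rmorphism S -> F}) :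
  zariski_closed (zeros phi).
Proof. by exists (fun p => phi p = 0). Qed.

Lemma zeros_point (F : fieldType) (phi : {rmorphism S -> F}) h :
  phi h != 0 -> exists2 v, zeros phi v & h.@[vcoord v] != 0.
Proof.
move=> /nullstellensatz [x [xP hx]]; exists (of_coord x).
  by move=> p /xP; rewrite meval_of_coord.
by rewrite meval_of_coord.
Qed.

Lemma vanishing_zeros (F : fieldType) (phi : {rmorphism S -> F}) p :
  vanishing_ideal (zeros phi) p <-> phi p = 0.
Proof.
split=> [Ip|p0 v]; last exact.
apply/eqP; apply: contrapT => /negP /zeros_point [v /Ip ->].
by rewrite eqxx.
Qed.

Lemma zeros_irreducible (F : fieldType) (phi : {rmorphism S -> F}) :
  irreducible zariski_closed (zeros phi).
Proof.
split=> [|A B clA clB AB].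
  have [|v vz _] := @zeros_point _ phi 1; first by rewrite rmorph1 oner_neq0.
  by exists v.
apply: contrapT => /not_orP [/existsNP [u /not_implyP [zu nAu]]
  /existsNP [v /not_implyP [zv nBv]]].
have {nAu} : ~ forall p, vanishing_ideal A p -> p.@[vcoord u] = 0.
  by move=> h; apply: nAu; apply/zariski_closedE.
move=> /existsNP [p /not_implyP [pA pu]].
have {nBv} : ~ forall p, vanishing_ideal B p -> p.@[vcoord v] = 0.
  by move=> h; apply: nBv; apply/zariski_closedE.
move=> /existsNP [q /not_implyP [qB qv]].
have : phi (p * q) = 0.
  apply/vanishing_zeros => w /AB [/pA|/qB] e; rewrite rmorphM /= e ?mul0r //.
  by rewrite mulr0.
move/eqP; rewrite rmorphM mulf_eq0 => /orP [] /eqP.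
  by move/zu.
by move/zv.
Qed.

(** Each step of [tdeg_step] lowers the dimension by exactly one, and none of the
    primes obtained contains [h], so a point outside [h = 0] lies on the last one. *)
Lemma zeros_chain (F : fieldType) (phi : {rmorphism S -> F}) h : phi h != 0 ->
  exists x Z, [/\ irreducible_chain (zeros phi) x (tdeg phi) Z,
    Z (tdeg phi) = zeros phi & h.@[vcoord x] != 0].
Proof.
move ed : (tdeg phi) => d; elim: d F phi ed => [|d IH] F phi ed h0.
  have [x zx hx] := zeros_point h0; exists x, (fun=> zeros phi); split=> //.
  split=> // i _; split=> //; [exact: zeros_closed|exact: zeros_irreducible].
have [|F' [phi' [sub [g g' g0] h' le]]] := tdeg_step h0; first by rewrite ed.
have ed' : tdeg phi' = d.
  have := tdeg_drop sub g' g0; rewrite ed ltnS => le1.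
  by apply/eqP; rewrite eqn_leq le1 -ltnS -ed.
have [x [Z [[Zi Zlt] Zd hx]]] := IH F' phi' ed' h'.
have zsub v : zeros phi' v -> zeros phi v by move=> vz p /sub /vz.
exists x, (fun i => if (i <= d)%N then Z i else zeros phi).
split; [|by rewrite ltnn|by []]; split=> [i _|i].
  case: ifP => [id|_].
    have [cl irr Zx Zs] := Zi i id; split=> //.
    by move=> v /Zs /zsub.
  split=> //; [exact: zeros_closed|exact: zeros_irreducible|].
  by apply: zsub; rewrite -Zd; have [] := Zi d (leqnn d).
rewrite ltnS => id; rewrite id; case: ifP => id'; first exact: Zlt.
have -> : i = d by apply/eqP; rewrite eqn_leq id leqNgt id'.
rewrite Zd; split=> // s; have [v zv gv] := zeros_point g0.
by move: gv; rewrite (s v zv) ?eqxx.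
Qed.

(** The transcendence degree grows strictly along a chain. *)
Lemma chain_length (F : fieldType) (phi : {rmorphism S -> F}) x e Z :
  irreducible_chain (zeros phi) x e Z -> (e <= tdeg phi)%N.
Proof.
move=> [Zi Zlt].
have key i (F' : fieldType) (phi' : {rmorphism S -> F'}) : (i <= e)%N ->
    (forall p, phi' p = 0 <-> vanishing_ideal (Z i) p) -> (i <= tdeg phi')%N.
  elim: i F' phi' => // i IH F' phi' ie ker.
  have [cl irr _ _] := Zi i (ltnW ie).
  have [F'' [phi'' [ker' _]]] := residue_field (irreducible_prime irr).
  have [sub nsub] := Zlt i ie.
  have [v Zv nZv] : exists2 v, Z i.+1 v & ~ Z i v.
    by apply: contrapT => no; apply: nsub => v Zv; apply: contrapT => nv; apply: no; exists v.
  have : ~ forall p, vanishing_ideal (Z i) p -> p.@[vcoord v] = 0.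
    by move=> /(zariski_closedE v cl).
  move=> /existsNP [p /not_implyP [pZ pv]].
  apply: leq_ltn_trans (IH _ phi'' (ltnW ie) ker') _.
  apply: (@tdeg_drop _ _ _ _ phi' phi'' p) => [q /ker qZ||].
  - by apply/ker' => w /sub /qZ.
  - exact/ker'.
  - by apply/eqP => /ker /(_ v Zv).
have [cl irr _ Zs] := Zi e (leqnn e).
have [F' [phi' [ker _]]] := residue_field (irreducible_prime irr).
apply: leq_trans (key e F' phi' (leqnn e) ker) _.
by apply: tdeg_le => p p0; apply/ker => v /Zs; apply.
Qed.

Section Smooth.
Context {F : fieldType} (phi : {rmorphism S -> F}).
Hypothesis fracs : forall z, exists x y, phi y != 0 /\ z = phi x / phi y.
Context {m : nat} (f : 'I_m -> S).
Hypothesis kerf : forall p, phi p = 0 <-> ideal_generated_by f p.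

(** The gradients of the equations are the columns, so that a row vector [v] is
    tangent when [v *m jacobian] vanishes. *)
Definition jacobian : 'M[S]_(N, m) := \matrix_(j, i) (f i)^`M(j).

Lemma gen_mem i : ideal_generated_by f (f i).
Proof.
exists (fun j => (j == i)%:R); rewrite (bigD1 i) //= eqxx mul1r big1 ?addr0 // => j.
by move/negPf ->; rewrite mul0r.
Qed.

Lemma zerosE v : zeros phi v <-> forall i, (f i).@[vcoord v] = 0.
Proof.
split=> [zv i|fv p /kerf [a ->]]; first by apply/zv/kerf/gen_mem.
by rewrite rmorph_sum big1 // => i _; rewrite rmorphM /= fv mulr0.
Qed.

Lemma tangent_jacobian (F' : fieldType) (psi : {rmorphism S -> F'}) (v : 'I_N -> F') :
  (forall i, psi (f i) = 0) ->
  (\row_j v j *m map_mx psi jacobian = 0 <->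
   forall p, ideal_generated_by f p -> deriv_along psi v p = 0).
Proof.
move=> fz.
have dE i : (\row_j v j *m map_mx psi jacobian) 0 i = deriv_along psi v (f i).
  by rewrite mxE; apply: eq_bigr => j _; rewrite !mxE mulrC.
split=> [vJ p [a ->]|tv]; last first.
  by apply/rowP => i; rewrite dE mxE; apply: tv; apply: gen_mem.
rewrite raddf_sum big1 // => i _; rewrite [LHS]deriv_alongM fz mulr0 add0r.
by rewrite -dE vJ mxE mulr0.
Qed.

Lemma mem_tangent x v : zeros phi x ->
  v \in tangent_space (zeros phi) x <->
  crow v *m map_mx (meval (vcoord x)) jacobian = 0.
Proof.
move=> zx; rewrite mem_tangent_space.
rewrite (@tangent_jacobian _ (meval (vcoord x)) (vcoord v)); last by apply/zerosE.
by split=> tv p; [move=> /kerf /vanishing_zeros /tv|move=> /vanishing_zeros /kerf /tv].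
Qed.

(** At the generic point the tangent space has the dimension of the variety. *)
Lemma rank_jacobian : (\rank (map_mx phi jacobian) + tdeg phi)%N = N.
Proof.
have fz i : phi (f i) = 0 by apply/kerf/gen_mem.
apply/eqP; rewrite eqn_leq tangent_dim_ge /=; last first.
  by move=> v tv; apply/(tangent_jacobian v fz) => p /kerf /tv.
apply: tangent_dim_le => v vJ p /kerf; move: p; apply/(tangent_jacobian (v 0) fz).
by rewrite -[RHS]vJ; congr (_ *m _); apply/rowP => i; rewrite mxE.
Qed.

(** The rank of a matrix of polynomials is constant on a nonempty open set.  A
    factorization through dimension [r] bounds it from above, and a product
    [L M T] equal to the identity of size [r] bounds it from below; cleared of
    denominators, both identities specialize. *)
Lemma rank_specialize a b (M : 'M[S]_(a, b)) : exists q, phi q != 0 /\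
  forall x, zeros phi x -> q.@[vcoord x] != 0 ->
  \rank (map_mx (meval (vcoord x)) M) = \rank (map_mx phi M).
Proof.
set M1 := map_mx phi M; set r := \rank M1.
have spec c d (A B : 'M[S]_(c, d)) x : map_mx phi A = map_mx phi B -> zeros phi x ->
    map_mx (meval (vcoord x)) A = map_mx (meval (vcoord x)) B.
  move=> AB zx; apply/matrixP => i j; rewrite !mxE; apply/eqP.
  rewrite -subr_eq0 -rmorphB; apply/eqP/zx.
  by have /matrixP /(_ i j) := AB; rewrite !mxE rmorphB => ->; rewrite subrr.
have [q1 [C' [q10 eC]]] := clear_denominators (col_base M1) fracs.
have [q2 [R' [q20 eR]]] := clear_denominators (row_base M1) fracs.
have [q3 [L' [q30 eL]]] := clear_denominators (pinvmx (col_base M1)) fracs.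
have [q4 [T' [q40 eT]]] := clear_denominators (pinvmx (row_base M1)) fracs.
exists (q1 * q2 * q3 * q4); split; first by rewrite !rmorphM !mulf_neq0.
move=> x zx; rewrite !rmorphM !mulf_eq0 /= !negb_or -!andbA => /and4P [q1x q2x q3x q4x].
set ev := meval (vcoord x).
apply/eqP; rewrite eqn_leq; apply/andP; split.
  have : map_mx phi ((q1 * q2) *: M) = map_mx phi (C' *m R').
    rewrite map_mxZ map_mxM eC eR rmorphM -scalemxAl -scalemxAr scalerA.
    by rewrite [col_base _ *m _]mulmx_base.
  move=> /spec /(_ zx); rewrite map_mxZ map_mxM => e.
  have q12 : ev (q1 * q2) != 0 by rewrite /ev rmorphM mulf_neq0.
  rewrite -(@mxrank_scale_nz _ _ _ (ev (q1 * q2))) //.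
  by rewrite e (leq_trans (mxrankM_maxl _ _)) // rank_leq_col.
have : map_mx phi (L' *m M *m T') = map_mx phi ((q3 * q4)%:M).
  rewrite !map_mxM eL eT map_scalar_mx rmorphM -!scalemxAl -scalemxAr scalerA.
  rewrite -[map_mx phi M](mulmx_base M1) mulmxA mulVpmx ?col_base_full // mul1mx.
  by rewrite mulmxVp ?row_base_free // scalemx1.
move=> /spec /(_ zx); rewrite map_scalar_mx !map_mxM => e.
have : \rank ((ev (q3 * q4))%:M : 'M[K]_r) = r.
  have q34 : ev (q3 * q4) != 0 by rewrite /ev rmorphM mulf_neq0.
  by rewrite -scalemx1 mxrank_scale_nz ?mxrank1.
rewrite -e => {1}<-.
by rewrite (leq_trans (mxrankM_maxl _ _)) // mxrankM_maxr.
Qed.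

(** The points where the Jacobian matrix has its generic rank and through which
    a chain of maximal length passes are smooth, and they are dense. *)
Lemma smooth_dense h : phi h != 0 ->
  exists2 x, smooth_point (zeros phi) x & h.@[vcoord x] != 0.
Proof.
move=> h0; have [q [q0 qP]] := rank_specialize jacobian.
have [|x [Z [chain Zd]]] := @zeros_chain _ phi (h * q).
  by rewrite rmorphM mulf_neq0.
rewrite rmorphM mulf_eq0 negb_or => /andP [hx qx].
have zx : zeros phi x by have [Zi _] := chain; have [_ _ Zx Zs] := Zi _ (leq0n _); exact: Zs.
exists x => //; split=> //.
have -> : \dim (tangent_space (zeros phi) x) = tdeg phi.
  apply/eqP; rewrite -(eqn_add2r (\rank (map_mx phi jacobian))).
  rewrite [X in _ == X]addnC rank_jacobian -(qP x zx qx).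
  by apply/eqP/dim_kernel => v; apply: mem_tangent.
by split; [exists Z|move=> e Z' /chain_length].
Qed.

End Smooth.
End Zeros.

(** * Homogeneous polynomials *)

Section Homogeneity.
Context {K : numClosedFieldType} {N : nat}.
Local Notation S := {mpoly K[N]}.
Local Notation component := (pihomog mdeg).
Implicit Types (p q : S) (x : 'I_N -> K).

Lemma components p d : (msize p <= d)%N -> p = \sum_(i < d) component i p.
Proof. exact: pihomog_partitionE. Qed.

Lemma homog_rmorph_scale (F : comNzRingType) (f g : {rmorphism S -> F}) t d p :
  (forall c, f c%:MP = g c%:MP) -> (forall i, f 'X_i = t * g 'X_i) ->
  p \is d.-homog -> f p = t ^+ d * g p.
Proof.
move=> fgC fgX /dhomogP hp; rewrite {1 2}[p]mpolyE !rmorph_sum mulr_sumr.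
rewrite big_seq [RHS]big_seq; apply: eq_bigr => m /hp em.
rewrite -!mul_mpolyC !rmorphM fgC mulrCA; congr (_ * _).
have -> : t ^+ d = \prod_i t ^+ m i by rewrite prodrXr -mdegE -em.
rewrite mpolyXE_id !rmorph_prod -big_split /=; apply: eq_bigr => i _.
by rewrite !rmorphXn fgX exprMn.
Qed.

Lemma homog_meval_scale t x p d :
  p \is d.-homog -> p.@[fun i => t * x i] = t ^+ d * p.@[x].
Proof.
apply: (homog_rmorph_scale (f := meval (fun i => t * x i)) (g := meval x)).
  by move=> c; rewrite /= !mevalC.
by move=> i; rewrite /= !mevalXU.
Qed.

(** The restriction of a polynomial to the line through [x]. *)
Definition ray x : {rmorphism S -> {poly K}} := mmap polyC (fun i => x i *: 'X).

Lemma ray_homog x p d : p \is d.-homog -> ray x p = p.@[x] *: 'X^d.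
Proof.
move=> hp; rewrite (homog_rmorph_scale (g := polyC \o meval x) (t := 'X) _ _ hp).
- by rewrite /= -mul_polyC mulrC.
- by move=> c; rewrite /= mmapC mevalC.
- by move=> i; rewrite /= mmapX mmap1U mevalXU -mul_polyC mulrC.
Qed.

Lemma coef_ray x p d : (ray x p)`_d = (component d p).@[x].
Proof.
rewrite {1}(components (leq_maxl (msize p) d.+1)) rmorph_sum coef_sum.
have lt : (d < maxn (msize p) d.+1)%N by rewrite leq_max ltnSn orbT.
rewrite (bigD1 (Ordinal lt)) //= big1 => [|i ne].
  by rewrite [mmap _ _ _](ray_homog x (pihomogP _ _ _)) coefZ coefXn eqxx mulr1 addr0.
rewrite [mmap _ _ _](ray_homog x (pihomogP _ _ _)) coefZ coefXn.
suff /negPf -> : d != i by rewrite mulr0.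
by rewrite eq_sym.
Qed.

Lemma horner_ray x p t : (ray x p).[t] = p.@[fun i => t * x i].
Proof.
move: p; apply: (@rmorph_mpoly_eq _ _ _ (horner_eval t \o ray x) (meval (fun i => t * x i))).
  by move=> c /=; rewrite mmapC /horner_eval hornerC mevalC.
by move=> i /=; rewrite mmapX mmap1U /horner_eval hornerZ hornerX mevalXU mulrC.
Qed.

Lemma ray_eq0 x p : (forall t, p.@[fun i => t * x i] = 0) -> ray x p = 0.
Proof.
move=> z; apply/eqP; apply: contrapT => /negP r0.
have : (size [seq (i%:R : K) | i <- iota 0 (size (ray x p))] < size (ray x p))%N.
  apply: max_poly_roots => //.
    by apply/allP => _ /mapP [i _ ->]; rewrite /root horner_ray z.
  by rewrite map_inj_uniq ?iota_uniq // => i j /eqP; rewrite eqr_nat => /eqP.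
by rewrite size_map size_iota ltnn.
Qed.

Lemma euler_identity p d : p \is d.-homog -> \sum_i 'X_i * p^`M(i) = d%:R * p.
Proof.
move=> /dhomogP hp; transitivity (\sum_(m <- msupp p) p@_m *: ((mdeg m)%:R * 'X_[m] : S)).
  rewrite (eq_bigr (fun i => \sum_(m <- msupp p) p@_m *: ('X_i * 'X_[m]^`M(i)))).
    rewrite exchange_big /=; apply: eq_bigr => m _; rewrite -scaler_sumr; congr (_ *: _).
    rewrite mdegE natr_sum mulr_suml; apply: eq_bigr => i _.
    rewrite mderivX -scalerAr -mpolyXD.
    have [->|mi] := eqVneq (m i) 0%N; first by rewrite scale0r mul0r.
    by rewrite addmC submK ?lep1mP // mulr_natl scaler_nat.
  move=> i _; rewrite {1}[p]mpolyE raddf_sum mulr_sumr; apply: eq_bigr => m _.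
  by rewrite [X in _ * X]mderivZ -scalerAr.
rewrite [in RHS](mpolyE p) mulr_sumr big_seq [RHS]big_seq; apply: eq_bigr => m /hp <-.
by rewrite -scalerAr.
Qed.

Lemma mderiv_homog p d i : p \is d.-homog -> p^`M(i) \is d.-1.-homog.
Proof.
move=> /dhomogP hp; apply/dhomogP => m; rewrite mcoeff_msupp mcoeff_mderiv.
move=> c0; have : (m + U_(i))%MM \in msupp p.
  by rewrite mcoeff_msupp; apply: contraNneq c0 => ->; rewrite mul0rn.
by move/hp; rewrite /= mdegD mdeg1 addn1 => <-.
Qed.

Lemma homog0_const p : p \is 0.-homog -> p = (p.@[fun=> 0])%:MP.
Proof.
move=> /dhomogP hp; suff qC : p = (p@_0)%:MP by rewrite {2}qC mevalC.
apply/mpolyP => m; rewrite mcoeffC; have [-> | m0] := eqVneq m 0%MM.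
  by rewrite mulr1.
rewrite mulr0; apply/eqP; rewrite mcoeff_eq0.
by apply: contra m0 => /hp /= /eqP; rewrite mdeg_eq0.
Qed.

Lemma homog1_deriv p j : p \is 1.-homog -> p^`M(j) = (p^`M(j).@[fun=> 0])%:MP.
Proof. by move=> hp; apply/homog0_const/(mderiv_homog j hp). Qed.

Lemma homog1_eval p x : p \is 1.-homog -> p.@[x] = \sum_i p^`M(i).@[fun=> 0] * x i.
Proof.
move=> hp; have := euler_identity hp; rewrite mul1r => /(congr1 (meval x)) <-.
rewrite rmorph_sum; apply: eq_bigr => i _.
by rewrite {1}(homog1_deriv i hp) rmorphM /= mevalXU mevalC mulrC.
Qed.

End Homogeneity.

Local Notation component := (pihomog mdeg).

(** * Cones and Lagrangian subspaces *)

Section Cone.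
Context {K : numClosedFieldType} {V : vectType K}.
Local Notation N := (\dim {:V}).
Local Notation S := {mpoly K[N]}.
Variable X : set (projective_space V).
Local Notation Y := (affine_cone X).

Lemma vcoordZ a (v : V) i : vcoord (a *: v) i = a * vcoord v i.
Proof. by rewrite /vcoord linearZ. Qed.

Lemma homog_vcoordZ a (v : V) (p : S) d :
  p \is d.-homog -> p.@[vcoord (a *: v)] = a ^+ d * p.@[vcoord v].
Proof.
by move=> hp; rewrite -(homog_meval_scale _ _ hp); apply: meval_eq => i; rewrite vcoordZ.
Qed.

Lemma cone_scale a v : Y v -> Y (a *: v).
Proof.
case=> [->|[L XL vL]]; first by left; rewrite scaler0.
by right; exists L; rewrite ?memvZ.
Qed.

Lemma cone_ray v (p : S) : Y v -> vanishing_ideal Y p -> ray (vcoord v) p = 0.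
Proof.
move=> Yv Ip; apply: ray_eq0 => t; rewrite -(Ip _ (cone_scale t Yv)).
by apply: meval_eq => i; rewrite vcoordZ.
Qed.

Lemma cone_component (p : S) d :
  vanishing_ideal Y p -> vanishing_ideal Y (component d p).
Proof. by move=> Ip v Yv; rewrite -coef_ray cone_ray // coef0. Qed.

Lemma line_gen (L : projective_space V) :
  exists2 v, v != 0 & line_of L = <[v]>%VS.
Proof.
have dL : \dim (line_of L) = 1%N by apply/eqP; exact: (valP L).
have v0 : vpick (line_of L) != 0.
  by rewrite vpick0; apply: contra_eq_neq dL => ->; rewrite dimv0.
exists (vpick (line_of L)) => //; apply/eqP; rewrite eq_sym eqEdim.
by rewrite -memvE memv_pick dL dim_vline v0.
Qed.

Lemma line_exists (v : V) : v != 0 -> exists L, line_of L = <[v]>%VS.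
Proof.
move=> v0; have dv : (\dim <[v]> == 1)%N by rewrite dim_vline v0.
by exists (exist _ <[v]>%VS dv).
Qed.

Lemma line_of_inj (L L' : projective_space V) : line_of L = line_of L' -> L = L'.
Proof. exact: val_inj. Qed.

Lemma cone_line (L : projective_space V) v :
  Y v -> v != 0 -> line_of L = <[v]>%VS -> X L.
Proof.
move=> Yv v0 eL; case: Yv => [/eqP|[L' XL' vL']]; first by rewrite (negPf v0).
have -> // : L = L'; apply: line_of_inj; rewrite eL.
have [w w0 eL'] := line_gen L'; move: vL'; rewrite eL' => /vlineP [a ea].
apply/eqP; rewrite eqEdim -memvE ea memvZ ?memv_line // !dim_vline w0.
by rewrite -ea v0.
Qed.

(** If [p * q] vanishes on a cone, then on each of its lines [p] or [q]
    vanishes; the lines on which [p] vanishes form a closed set, cut out by the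
    homogeneous components of [p]. *)
Lemma cone_prime :
  irreducible projective_closed X -> prime_ideal (vanishing_ideal Y).
Proof.
case=> [[L0 XL0] irr]; split; first exact: ideal_vanishing.
  have /[swap] /[apply] : Y 0 by left.
  by move/eqP; rewrite rmorph1 oner_eq0.
move=> p q Ipq.
pose Z (r : S) : set (projective_space V) :=
  fun L => forall s v, (exists d, s = component d r) -> v \in line_of L -> s.@[vcoord v] = 0.
have clZ r : projective_closed (Z r).
  exists (fun s => exists d, s = component d r) => //.
  by move=> _ [d ->]; exists d; apply: pihomogP.
have IZ r : (forall L, X L -> Z r L) -> vanishing_ideal Y r.
  move=> XZ v Yv; rewrite [r](components (leqnn _)) rmorph_sum big1 // => d _.
  case: Yv => [->|[L XL vL]]; last by apply: (XZ L XL) => //; exists d.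
  by apply: (XZ L0 XL0); [exists d|rewrite mem0v].
have [|Xp|Xq] := irr _ _ (clZ p) (clZ q); [|left; exact: IZ|right; exact: IZ].
move=> L XL; have [v v0 eL] := line_gen L.
have vL : v \in line_of L by rewrite eL memv_line.
have Yv : Y v by right; exists L.
have Zr r : ray (vcoord v) r = 0 -> Z r L.
  move=> r0 _ w [d ->]; rewrite eL => /vlineP [a ->].
  by rewrite (homog_vcoordZ _ _ (pihomogP _ _ _)) -coef_ray r0 coef0 mulr0.
have /eqP := cone_ray Yv Ipq.
by rewrite rmorphM mulf_eq0 => /orP [] /eqP /Zr; [left|right].
Qed.

Lemma cone_closed v : projective_closed X -> (exists L, X L) ->
  (forall p, vanishing_ideal Y p -> p.@[vcoord v] = 0) -> Y v.
Proof.
move=> [I hI eX] [L0 XL0] vI; have [->|v0] := eqVneq v 0; first by left.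
have XI L : X L -> forall p w, I p -> w \in line_of L -> p.@[vcoord w] = 0 by rewrite eX.
have [L eL] := line_exists v0; right; exists L; last by rewrite eL memv_line.
rewrite eX => p w Ip; rewrite eL => /vlineP [a ->].
have [d hp] := hI p Ip; rewrite (homog_vcoordZ _ _ hp) vI ?mulr0 // => u.
case=> [->|[L' XL' uL']]; last exact: XI uL'.
by apply: (XI _ XL0) => //; rewrite mem0v.
Qed.

End Cone.

Section Lagrangian.
Context {K : numClosedFieldType} {V : vectType K}.
Local Notation N := (\dim {:V}).
Variable omega : {skew_symmetric V}.
Hypothesis omegaP : is_psymplectic omega.

Definition form_matrix : 'M[K]_N :=
  \matrix_(i, j) omega (vbasis {:V})`_i (vbasis {:V})`_j.
Local Notation Om := form_matrix.

Lemma form_matrixE u v : omega u v = (crow u *m Om *m (crow v)^T) 0 0.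
Proof.
rewrite -{1}(vcoordK u) -{1}(vcoordK v) /of_coord.
rewrite linear_sumlz /= -mulmxA mxE; apply: eq_bigr => i _.
rewrite linearZl_LR /= mxE; congr (_ * _); rewrite linear_sumr mxE; apply: eq_bigr => j _.
by rewrite linearZr /= !mxE mulrC.
Qed.

Lemma omega_skew u v : omega u v = - omega v u.
Proof. by rewrite hermC expr1 mulN1r. Qed.

Lemma omega_alternating u : omega u u = 0.
Proof.
have /eqP := omega_skew u u; rewrite -addr_eq0 -mulr2n mulrn_eq0 /=.
by move/eqP.
Qed.

Lemma form_matrix_unit : Om \in unitmx.
Proof.
rewrite -row_free_unit; apply: inj_row_free => u uO.
have [/eqP nd _ _] := omegaP.
have : of_row u \in orthov omega fullv.
  by apply/mem_orthovP => v _; rewrite form_matrixE of_rowK uO mul0mx mxE.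
rewrite nd memv0 => /eqP /(congr1 crow); rewrite of_rowK.
by rewrite linear0.
Qed.

(** A column [g] of [J] is the gradient of a function, and the corresponding row
    [h] satisfies [h *m Om *m v^T = v *m g] for all [v]: it is the Hamiltonian
    vector of that function. *)
Definition hamiltonian m (J : 'M[K]_(N, m)) : 'M[K]_(m, N) := J^T *m invmx Om.

(** A Lagrangian subspace cut out by [J] is its own orthogonal, and its
    orthogonal is spanned by the Hamiltonian vectors of the equations. *)
Lemma lagrangian_jacobian m (J : 'M[K]_(N, m)) (W : {vspace V}) :
  (forall v, v \in W <-> crow v *m J = 0) -> lagrangian omega W ->
  hamiltonian J *m J = 0 /\ (\rank J + \rank J)%N = N.
Proof.
move=> WJ [isoW maxW]; have uO := form_matrix_unit.
have orthW u : (forall w, w \in W -> omega u w = 0) -> u \in W.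
  move=> uW; have <- := maxW (W + <[u]>)%VS; last exact: addvSl.
    by rewrite (subvP (addvSr _ _)) ?memv_line.
  move=> _ _ /memv_addP [w1 W1 [_ /vlineP [a1 ->] ->]] /memv_addP [w2 W2 [_ /vlineP [a2 ->] ->]].
  rewrite linearDl linearDr linearDr !linearZl_LR !linearZr /= isoW // uW //.
  by rewrite (omega_skew w1) uW // omega_alternating !mulr0 oppr0 mulr0 !addr0.
have HJ : hamiltonian J *m J = 0.
  apply/row_matrixP => i; rewrite row_mul row0 -(of_rowK (row i _)).
  apply/WJ/orthW => w /WJ wJ; rewrite form_matrixE of_rowK -row_mul -mulmxA.
  rewrite mulVmx // mulmx1 -row_mul -trmx_mul wJ trmx0.
  by rewrite row0 mxE.
split=> //.
have rH : \rank (hamiltonian J) = \rank J.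
  by rewrite mxrankMfree ?row_free_unit ?unitmx_inv // mxrank_tr.
apply/eqP; rewrite eqn_leq; apply/andP; split.
  have : (hamiltonian J <= kermx J)%MS by apply/sub_kermxP.
  move/mxrankS; rewrite rH mxrank_ker => le.
  by rewrite -leq_subRL // ?rank_leq_row.
have : (kermx J <= hamiltonian J)%MS.
  apply/row_subP => i; set u := row i _.
  have uJ : u *m J = 0 by apply/sub_kermxP; rewrite row_sub.
  have uW : of_row u \in W by apply/WJ; rewrite of_rowK.
  suff : (u *m Om <= J^T)%MS.
    by case/submxP => D eD; rewrite -[u](mulmxK uO) eD -mulmxA submxMl.
  rewrite submxE; set C := cokermx _.
  have : (C^T <= kermx J)%MS.
    by apply/sub_kermxP; apply: trmx_inj; rewrite trmx_mul trmxK mulmx_coker trmx0.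
  case/submxP => D eD; rewrite -[C]trmxK eD trmx_mul mulmxA.
  suff -> : u *m Om *m (kermx J)^T = 0 by rewrite mul0mx.
  apply/rowP => j; rewrite mxE.
  have wW : of_row (row j (kermx J)) \in W.
    by apply/WJ; rewrite of_rowK -row_mul mulmx_ker row0.
  have := isoW _ _ uW wW; rewrite form_matrixE !of_rowK => e.
  by rewrite [RHS]mxE -[RHS]e !mxE; apply: eq_bigr => l _; rewrite !mxE.
by move/mxrankS; rewrite rH mxrank_ker leq_subLR.
Qed.

End Lagrangian.

(** * The Hamiltonian vector fields of the equations *)

Section Generic.
Context {K : numClosedFieldType} {V : vectType K} {n : nat}.
Local Notation N := (\dim {:V}).
Local Notation S := {mpoly K[N]}.
Variables (omega : {skew_symmetric V}) (X : set (projective_space V)).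
Local Notation Y := (affine_cone X).
Hypothesis dimV : N = (2 * n)%N.
Hypothesis omegaP : is_psymplectic omega.
Hypothesis closedX : projective_closed X.
Hypothesis legX : legendrian omega X.
Hypothesis irrX : irreducible projective_closed X.
Context {F : fieldType} (phi : {rmorphism S -> F}).
Hypothesis ker_phi : forall p, phi p = 0 <-> vanishing_ideal Y p.
Hypothesis fracs : forall z, exists x y, phi y != 0 /\ z = phi x / phi y.
Variables (f : 'I_n -> S) (e : 'I_n -> nat).
Hypothesis homf : forall i, f i \is (e i).-homog.
Hypothesis genf : homogeneous_ideal X = ideal_generated_by f.

Lemma ker_gen p : phi p = 0 <-> ideal_generated_by f p.
Proof. by rewrite -genf ker_phi. Qed.

Lemma cone_zeros : zeros phi = Y.
Proof.
apply/seteqP; split=> v; last by move=> Yv p /ker_phi; apply.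
move=> zv; apply: cone_closed => //; first by case: irrX => -[L XL] _; exists L.
by move=> p /ker_phi /zv.
Qed.

Lemma ker_component p d : phi p = 0 -> phi (component d p) = 0.
Proof. by move=> /ker_phi /(@cone_component _ _ _ _ d) /ker_phi. Qed.

Lemma coordinate_neq0 : exists j, phi 'X_j != 0.
Proof.
have [[L XL] _] := irrX; have [v v0 eL] := line_gen L.
have Yv : Y v by right; exists L => //; rewrite eL memv_line.
apply: contrapT => no; move/eqP: v0; apply; apply: vcoord_inj => j.
have /ker_phi /(_ v Yv) : phi 'X_j = 0.
  by apply/eqP; apply: contrapT => /negP Xj; apply: no; exists j.
by rewrite mevalXU => ->; rewrite /vcoord linear0.
Qed.

Local Notation J := (jacobian f).

Definition hamiltonian_fields : 'M[S]_(n, N) :=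
  J^T *m map_mx (@mpolyC N K) (invmx (form_matrix omega)).
Local Notation ham := hamiltonian_fields.

Lemma map_ham (A : comNzRingType) (g : {rmorphism S -> A}) :
  map_mx g ham = (map_mx g J)^T *m map_mx (g \o @mpolyC N K) (invmx (form_matrix omega)).
Proof. by rewrite map_mxM map_trmx -map_mx_comp. Qed.

Lemma rank_ham (F' : fieldType) (g : {rmorphism S -> F'}) :
  \rank (map_mx g ham) = \rank (map_mx g J).
Proof.
rewrite map_ham mxrankMfree ?mxrank_tr // row_free_unit map_unitmx unitmx_inv.
exact: form_matrix_unit.
Qed.

Lemma ham_homog i j : ham i j \is (e i).-1.-homog.
Proof.
rewrite mxE; apply: rpred_sum => k _; rewrite !mxE mulrC mul_mpolyC.
exact/rpredZ/mderiv_homog.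
Qed.

(** At a smooth point the tangent space is Lagrangian; smooth points being
    dense, what it says about the Jacobian matrix holds generically. *)
Lemma generic_point h : phi h != 0 ->
  exists x (W : {vspace V}), [/\ Y x, h.@[vcoord x] != 0, lagrangian omega W &
    forall v, v \in W <-> crow v *m map_mx (meval (vcoord x)) J = 0].
Proof.
move=> h0; have [j Xj] := coordinate_neq0.
have [|x smx] := @smooth_dense _ _ _ phi fracs _ f ker_gen (h * 'X_j).
  by rewrite rmorphM mulf_neq0.
rewrite rmorphM mulf_eq0 negb_or /= mevalXU => /andP [hx xj].
have zx : zeros phi x by case: smx.
have x0 : x != 0 by apply: contraNneq xj => ->; rewrite /vcoord linear0.
rewrite cone_zeros in smx; exists x, (tangent_space Y x); split=> //.
- by rewrite -cone_zeros.
- exact: legX.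
- by move=> v; rewrite -cone_zeros; apply: mem_tangent => //; apply: ker_gen.
Qed.

Lemma half_dim r : (r + r)%N = N -> r = n.
Proof.
by move=> d2; apply: double_inj; rewrite -addnn d2; apply: etrans dimV (mul2n n).
Qed.

Lemma generic_rank : \rank (map_mx phi J) = n.
Proof.
have [q [q0 qP]] := rank_specialize fracs J.
have [x [W [Yx qx lagW WJ]]] := generic_point q0.
have [_] := lagrangian_jacobian omegaP WJ lagW.
by rewrite qP // ?cone_zeros // => /half_dim.
Qed.

Lemma generic_tdeg : tdeg phi = n.
Proof.
have := rank_jacobian ker_gen; rewrite generic_rank => d.
by apply: (@addnI n); rewrite d; apply: etrans dimV _; rewrite mul2n addnn.
Qed.

Lemma generic_isotropic : map_mx phi ham *m map_mx phi J = 0.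
Proof.
rewrite -map_mxM; apply/matrixP => i j; rewrite !mxE.
apply/eqP; apply: contrapT => /negP p0.
have [x [W [Yx + lagW WJ]]] := generic_point p0.
have [Hx _] := lagrangian_jacobian omegaP WJ lagW.
have -> : (\sum_j0 ham i j0 * J j0 j).@[vcoord x] =
    (map_mx (meval (vcoord x)) ham *m map_mx (meval (vcoord x)) J) i j.
  by rewrite -map_mxM !mxE.
rewrite map_ham (_ : map_mx (meval (vcoord x) \o _) _ = invmx (form_matrix omega)).
  by rewrite [_ *m _ *m _]Hx mxE eqxx.
by apply/matrixP => k m; rewrite mxE /= mevalC.
Qed.

(** By Euler's identity the position vector is tangent to the cone, hence a
    combination of the Hamiltonian vectors. *)
Lemma euler_hamiltonian : exists a : 'rV[F]_n,
  \row_j phi 'X_j = a *m map_mx phi ham.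
Proof.
have le : (map_mx phi ham <= kermx (map_mx phi J))%MS.
  exact/sub_kermxP/generic_isotropic.
have eqr : \rank (map_mx phi ham) = \rank (kermx (map_mx phi J)).
  rewrite rank_ham mxrank_ker generic_rank; apply: (@addnI n).
  have nN : N = (n + n)%N by apply: etrans dimV _; rewrite mul2n addnn.
  rewrite subnKC; first exact: esym nN.
  exact: leq_trans (leq_addr n n) (eq_leq (esym nN)).
have eqm : (kermx (map_mx phi J) <= map_mx phi ham)%MS.
  by have := (mxrank_leqif_sup le).2; rewrite eqr eqxx.
apply/submxP; apply: submx_trans eqm; apply/sub_kermxP/rowP => i.
rewrite !mxE; transitivity (phi (\sum_j 'X_j * (f i)^`M(j))).
  by rewrite rmorph_sum; apply: eq_bigr => j _; rewrite !mxE rmorphM.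
rewrite (euler_identity (homf i)) rmorphM.
suff -> : phi (f i) = 0 by rewrite mulr0.
exact/ker_gen/gen_mem.
Qed.

Lemma ham_row_free : row_free (map_mx phi ham).
Proof. by rewrite /row_free rank_ham generic_rank. Qed.

End Generic.

(** * Affine charts and normality *)

(** A relation between two rings that is stable under the ring operations is
    stable under the characteristic polynomial. *)
Section RingRelation.
Context {A B : comNzRingType}.
Variable R : A -> B -> Prop.
Hypotheses (R0 : R 0 0) (R1 : R 1 1).
Hypothesis RD : forall a b c d, R a b -> R c d -> R (a + c) (b + d).
Hypothesis RN : forall a b, R a b -> R (- a) (- b).
Hypothesis RM : forall a b c d, R a b -> R c d -> R (a * c) (b * d).

Lemma rel_sum (I : Type) (r : seq I) (P : pred I) (a : I -> A) (b : I -> B) :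
  (forall i, P i -> R (a i) (b i)) -> R (\sum_(i <- r | P i) a i) (\sum_(i <- r | P i) b i).
Proof. by move=> ab; apply: (big_ind2 R). Qed.

Lemma rel_prod (I : Type) (r : seq I) (P : pred I) (a : I -> A) (b : I -> B) :
  (forall i, P i -> R (a i) (b i)) -> R (\prod_(i <- r | P i) a i) (\prod_(i <- r | P i) b i).
Proof. by move=> ab; apply: (big_ind2 R). Qed.

Lemma rel_exp a b m : R a b -> R (a ^+ m) (b ^+ m).
Proof.
by move=> ab; elim: m => [|m IH]; rewrite ?expr0 // !exprS; apply: RM.
Qed.

Lemma rel_det m (M : 'M[A]_m) (M' : 'M[B]_m) :
  (forall i j, R (M i j) (M' i j)) -> R (\det M) (\det M').
Proof.
move=> MM; apply: rel_sum => s _; apply: RM; last by apply: rel_prod.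
by apply/rel_exp/RN.
Qed.

End RingRelation.

Section PolyRelation.
Context {A B : comNzRingType}.
Variable R : A -> B -> Prop.
Hypotheses (R0 : R 0 0) (R1 : R 1 1).
Hypothesis RD : forall a b c d, R a b -> R c d -> R (a + c) (b + d).
Hypothesis RN : forall a b, R a b -> R (- a) (- b).
Hypothesis RM : forall a b c d, R a b -> R c d -> R (a * c) (b * d).

Definition coef_rel (p : {poly A}) (q : {poly B}) := forall i, R p`_i q`_i.

Lemma coef_rel_polyC a b : R a b -> coef_rel a%:P b%:P.
Proof. by move=> ab i; rewrite !coefC; case: eqP. Qed.

Lemma coef_rel_char_poly m (M : 'M[A]_m) (M' : 'M[B]_m) :
  (forall i j, R (M i j) (M' i j)) -> coef_rel (char_poly M) (char_poly M').
Proof.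
have D p q r s : coef_rel p q -> coef_rel r s -> coef_rel (p + r) (q + s).
  by move=> pq rs i; rewrite !coefD; apply: RD.
have O p q : coef_rel p q -> coef_rel (- p) (- q).
  by move=> pq i; rewrite !coefN; apply: RN.
have Z : coef_rel 0 0 by move=> i; rewrite !coef0.
move=> MM; apply: (@rel_det _ _ coef_rel) => //.
- by rewrite -!polyC1; apply: coef_rel_polyC.
- by move=> p q r s pq rs i; rewrite !coefM; apply: rel_sum => // j _; apply: RM.
- move=> i j; rewrite !mxE; apply: D; last by apply/O/coef_rel_polyC.
  by case: (i == j); rewrite ?mulr1n ?mulr0n // => l; rewrite !coefX; case: eqP.
Qed.

Lemma coef_rel_horner p q a b : coef_rel p q -> R a b -> R p.[a] q.[b].
Proof.
move=> pq ab; set m := maxn (size p) (size q).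
rewrite (@horner_coef_wide _ m p) ?leq_maxl // (@horner_coef_wide _ m q) ?leq_maxr //.
by apply: rel_sum => // i _; apply: RM => //; apply: rel_exp.
Qed.

End PolyRelation.

Section Chart.
Context {K : numClosedFieldType} {V : vectType K}.
Local Notation N := (\dim {:V}).
Local Notation S := {mpoly K[N]}.
Variable X : set (projective_space V).
Local Notation Y := (affine_cone X).
Context {F : fieldType} (phi : {rmorphism S -> F}).
Hypothesis ker_phi : forall p, phi p = 0 <-> vanishing_ideal Y p.
Variable l : 'I_N.

Definition homogenize D (p : S) : S :=
  \sum_(i < D.+1) component i p * 'X_l ^+ (D - i).

Lemma homogenize_homog D p : homogenize D p \is D.-homog.
Proof.
apply: rpred_sum => i _; have le : (i <= D)%N by rewrite -ltnS.
have hl : ('X_l ^+ (D - i) : S) \is (1 * (D - i))%N.-homog.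
  by apply: dhomogMn; rewrite dhomogX /= mdeg1.
by have := dhomogM (pihomogP _ i p) hl; rewrite mul1n subnKC.
Qed.

Lemma homogenize_dehom (A : comNzRingType) (g : {rmorphism S -> A}) D p :
  (msize p <= D.+1)%N -> g 'X_l = 1 -> g (homogenize D p) = g p.
Proof.
move=> sp gl; rewrite [in RHS](components sp) !rmorph_sum; apply: eq_bigr => i _.
by rewrite rmorphM rmorphXn gl expr1n mulr1.
Qed.

(** The generic point in the affine chart where the coordinate [l] is [1]. *)
Definition chart : {rmorphism S -> F} :=
  mmap (phi \o @mpolyC N K) (fun j => phi 'X_j / phi 'X_l).

Local Notation psi := chart.
Hypothesis l0 : phi 'X_l != 0.

Lemma chartX j : psi 'X_j = phi 'X_j / phi 'X_l.
Proof. by rewrite /= mmapX mmap1U. Qed.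

Lemma chartC c : psi c%:MP = phi c%:MP.
Proof. by rewrite /= mmapC. Qed.

Lemma chart_l : psi 'X_l = 1.
Proof. by rewrite chartX divff. Qed.

Lemma chart_homog p d : p \is d.-homog -> phi p = phi 'X_l ^+ d * psi p.
Proof.
apply: homog_rmorph_scale => [c|i]; first by rewrite chartC.
by rewrite chartX mulrC divfK.
Qed.

Lemma phi_homogenize D p : (msize p <= D.+1)%N ->
  phi (homogenize D p) = phi 'X_l ^+ D * psi p.
Proof.
move=> sp; rewrite (chart_homog (homogenize_homog D p)).
by rewrite homogenize_dehom // chart_l.
Qed.

Lemma chart_eq0 p : phi p = 0 -> psi p = 0.
Proof.
move=> /ker_phi Ip; rewrite [p](components (leqnn _)) rmorph_sum big1 // => i _.
have /ker_phi := cone_component i Ip; rewrite (chart_homog (pihomogP _ _ _)).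
by move/eqP; rewrite mulf_eq0 expf_eq0 (negPf l0) andbF => /eqP.
Qed.

Variables (v : V).
Hypotheses (Yv : Y v) (vl : vcoord v l = 1).

Lemma chart_ker_vanish p : psi p = 0 -> p.@[vcoord v] = 0.
Proof.
move=> p0; have /ker_phi /(_ v Yv) : phi (homogenize (msize p) p) = 0.
  by rewrite phi_homogenize // p0 mulr0.
rewrite -[_.@[_]]/(meval (vcoord v) _) homogenize_dehom //.
by rewrite /= mevalXU.
Qed.

Lemma chart_neq0 p : p.@[vcoord v] != 0 -> psi p != 0.
Proof. by apply: contra_neq; apply: chart_ker_vanish. Qed.

(** The local ring at the line through [v], and its fraction field, inside
    [F]. *)
Definition in_local z := exists p q, q.@[vcoord v] != 0 /\ z = psi p / psi q.
Definition in_fractions z := exists p q, psi q != 0 /\ z = psi p / psi q.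

Lemma in_local0 : in_local 0.
Proof. by exists 0, 1; rewrite !rmorph0 !rmorph1 mul0r oner_neq0. Qed.

Lemma in_localD a b : in_local a -> in_local b -> in_local (a + b).
Proof.
move=> [p [q [q0 ->]]] [r [s [s0 ->]]]; exists (p * s + r * q), (q * s).
rewrite [X in X != 0]rmorphM mulf_neq0 //; split=> //.
by rewrite addf_div ?chart_neq0 // [psi (_ + _)]rmorphD !(rmorphM psi).
Qed.

Lemma in_localM a b : in_local a -> in_local b -> in_local (a * b).
Proof.
move=> [p [q [q0 ->]]] [r [s [s0 ->]]]; exists (p * r), (q * s).
rewrite [X in X != 0]rmorphM mulf_neq0 //; split=> //.
by rewrite mulf_div !(rmorphM psi).
Qed.

Lemma in_local_psi p : in_local (psi p).
Proof. by exists p, 1; rewrite !rmorph1 oner_neq0 divr1. Qed.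

Lemma in_local_inv q : q.@[vcoord v] != 0 -> in_local (psi q)^-1.
Proof. by move=> q0; exists 1, q; rewrite rmorph1 mul1r. Qed.

(** [x] is a homogeneous fraction of degree zero with a denominator in [D], and
    [z] is its restriction to the variety.  With the denominators that are
    nonzero at [v] this describes the local ring, and with those that are nonzero
    at the generic point it describes the function field. *)
Definition ratio_rel (D : S -> Prop) (x : {fraction S}) (z : F) :=
  exists p q d, [/\ p \is d.-homog, q \is d.-homog, D q,
    x = tofrac p / tofrac q & z = phi p / phi q].

Section RatioRel.
Variable D : S -> Prop.
Hypotheses (D1 : D 1) (DM : forall p q, D p -> D q -> D (p * q)).
Hypothesis Dphi : forall q, D q -> phi q != 0.

Let D0 q : D q -> tofrac q != 0.
Proof.
by move=> /Dphi; rewrite tofrac_eq0; apply: contraNneq => ->; rewrite rmorph0.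
Qed.

Lemma ratio_rel0 : ratio_rel D 0 0.
Proof.
exists 0, 1, 0%N; rewrite !rmorph0 !mul0r; split=> //; first exact: dhomog0.
exact: dhomog1.
Qed.

Lemma ratio_rel1 : ratio_rel D 1 1.
Proof.
by exists 1, 1, 0%N; rewrite !rmorph1 !divr1; split=> //; apply: dhomog1.
Qed.

Lemma ratio_relD a b c d :
  ratio_rel D a b -> ratio_rel D c d -> ratio_rel D (a + c) (b + d).
Proof.
move=> [p [q [k [hp hq Dq -> ->]]]] [r [s [m [hr hs Ds -> ->]]]].
exists (p * s + r * q), (q * s), (k + m)%N; split.
- by apply: rpredD; [apply: dhomogM|rewrite addnC; apply: dhomogM].
- exact: dhomogM.
- exact: DM.
- by rewrite addf_div ?D0 // rmorphD !rmorphM.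
- by rewrite addf_div ?Dphi // rmorphD !rmorphM.
Qed.

Lemma ratio_relN a b : ratio_rel D a b -> ratio_rel D (- a) (- b).
Proof.
move=> [p [q [k [hp hq Dq -> ->]]]]; exists (- p), q, k; split=> //.
- by rewrite rpredN.
- by rewrite rmorphN mulNr.
- by rewrite rmorphN mulNr.
Qed.

Lemma ratio_relM a b c d :
  ratio_rel D a b -> ratio_rel D c d -> ratio_rel D (a * c) (b * d).
Proof.
move=> [p [q [k [hp hq Dq -> ->]]]] [r [s [m [hr hs Ds -> ->]]]].
exists (p * r), (q * s), (k + m)%N; split; try exact: dhomogM.
- exact: DM.
- by rewrite mulf_div !rmorphM.
- by rewrite mulf_div !rmorphM.
Qed.

End RatioRel.

Lemma fraction_ratio D (p q : S) : psi q != 0 ->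
  (forall E, (msize q <= E.+1)%N -> D (homogenize E q)) ->
  exists x, ratio_rel D x (psi p / psi q).
Proof.
move=> q0 Dq; set E := maxn (msize p) (msize q).
have sp : (msize p <= E.+1)%N by rewrite (leq_trans (leq_maxl _ _) (leqnSn _)).
have sq : (msize q <= E.+1)%N by rewrite (leq_trans (leq_maxr _ _) (leqnSn _)).
exists (tofrac (homogenize E p) / tofrac (homogenize E q)).
exists (homogenize E p), (homogenize E q), E.
split=> //; [exact: homogenize_homog|exact: homogenize_homog|exact: Dq|].
by rewrite !phi_homogenize // -mulf_div divff ?expf_neq0 // mul1r.
Qed.

(** Normality, read in the chart: an element of the fraction field that
    multiplies a nonzero vector as a matrix over the local ring does is
    integral, hence lies in the local ring. *)
Lemma local_integral m (U : 'M[F]_m) (c : 'rV[F]_m) z :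
  normal_variety X -> in_fractions z -> (forall i j, in_local (U i j)) ->
  c != 0 -> c *m U = z *: c -> in_local z.
Proof.
move=> norX [p [q [q0 ez]]] Uloc c0 cU.
have v0 : v != 0.
  by apply: contra_eq_neq vl => ->; rewrite /vcoord linear0 eq_sym oner_neq0.
have [L eL] := line_exists v0; have vL : v \in line_of L by rewrite eL memv_line.
have XL : X L by apply: cone_line eL.
pose Dl (r : S) := r.@[vcoord v] != 0.
pose Dg (r : S) := phi r != 0.
have Dl1 : Dl 1 by rewrite /Dl rmorph1 oner_neq0.
have DlM r s : Dl r -> Dl s -> Dl (r * s) by rewrite /Dl rmorphM; apply: mulf_neq0.
have Dlphi r : Dl r -> phi r != 0.
  by apply: contra_neq => /ker_phi; apply.
have Dg1 : Dg 1 by rewrite /Dg rmorph1 oner_neq0.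
have DgM r s : Dg r -> Dg s -> Dg (r * s) by rewrite /Dg rmorphM; apply: mulf_neq0.
have [x xz] : exists x, ratio_rel Dg x z.
  rewrite ez; apply: fraction_ratio => // E sE.
  by rewrite /Dg phi_homogenize // mulf_neq0 // expf_neq0.
have /choice [u uU] (ij : 'I_m * 'I_m) : exists y, ratio_rel Dl y (U ij.1 ij.2).
  have [r [s [s0 ->]]] := Uloc ij.1 ij.2; apply: fraction_ratio; first exact: chart_neq0.
  move=> E sE; rewrite /Dl -[X in X != 0]/(meval (vcoord v) _).
  by rewrite homogenize_dehom //= mevalXU.
pose M := \matrix_(i, j) u (i, j).
have MU i j : ratio_rel Dl (M i j) (U i j) by rewrite mxE; apply: uU.
have charMU : coef_rel (ratio_rel Dl) (char_poly M) (char_poly U).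
  apply: coef_rel_char_poly => //; [exact: ratio_rel0|exact: ratio_rel1| | |].
  - by move=> *; apply: ratio_relD.
  - by move=> *; apply: ratio_relN.
  - by move=> *; apply: ratio_relM.
have zroot : (char_poly U).[z] = 0.
  by apply/eqP; rewrite -[_ == 0]eigenvalue_root_char; apply/eigenvalueP; exists c.
have wk a b : ratio_rel Dl a b -> ratio_rel Dg a b.
  by move=> [r [s [d [hr hs /Dlphi Ds -> ->]]]]; exists r, s, d.
have ratI (r s : S) d : r \is d.-homog -> s \is d.-homog ->
    is_ratio (tofrac r / tofrac s) r s by move=> hr hs; split=> //; exists d.
have nI r : phi r != 0 -> ~ homogeneous_ideal X r.
  by move=> r0 /ker_phi rz; rewrite rz eqxx in r0.
have := norX L x XL; case.
- by case: xz => r [s [d [hr hs Ds -> _]]]; exists r, s; split; [exact: (ratI _ _ d)|exact: nI].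
- exists (char_poly M); first exact: char_poly_monic.
  split=> [i|].
    have [r [s [d [hr hs Ds -> _]]]] := charMU i.
    by exists r, s; split; [exact: (ratI _ _ d)|exists v].
  have : ratio_rel Dg (char_poly M).[x] 0.
    rewrite -zroot; apply: coef_rel_horner; rewrite ?zroot.
    + exact: ratio_rel0.
    + exact: ratio_rel1.
    + by move=> *; apply: ratio_relD.
    + by move=> *; apply: ratio_relM.
    + by move=> i; apply/wk/charMU.
    + exact: xz.
  case=> r [s [d [hr hs Ds -> /esym/eqP rz]]]; exists r, s; split.
  + exact: (ratI _ _ d).
  + exact: nI.
  + by apply/ker_phi/eqP; move: rz; rewrite mulf_eq0 invr_eq0 (negPf Ds) orbF.
move=> y [r [s [[[d [hr hs]] ->] [w + sw]]]]; rewrite eL => /vlineP [a ea].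
case=> r1 [s1 [[_ e1] nIs1 /ker_phi rz]].
have sv : s.@[vcoord v] != 0.
  by move: sw; rewrite ea (homog_vcoordZ _ _ hs) mulf_eq0 negb_or => /andP [].
have [px [qx [dx [hpx hqx qx0 ex ->]]]] := xz.
have s0 : phi s != 0 by apply: Dlphi.
have s10 : phi s1 != 0 by apply/eqP => /ker_phi.
have frac0 t : phi t != 0 -> tofrac t != 0.
  by rewrite tofrac_eq0; apply: contraNneq => ->; rewrite rmorph0.
move/eqP: e1; rewrite ex -mulNr addf_div ?frac0 // eqr_div ?mulf_neq0 ?frac0 //.
rewrite -rmorphN -!rmorphM -rmorphD -!rmorphM tofrac_eq => /eqP /(congr1 phi).
rewrite !rmorphM rz mul0r rmorphD !rmorphM rmorphN => /eqP.
rewrite mulf_eq0 (negPf s10) orbF mulNr subr_eq0 => /eqP eqf.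
exists r, s; split=> //; apply/eqP; rewrite eqr_div ?chart_neq0 //.
have {eqf} : phi px / phi qx = psi r / psi s.
  apply/eqP; rewrite eqr_div ?chart_neq0 //; apply/eqP.
  apply: (mulfI (expf_neq0 d l0)).
  by rewrite mulrCA -(chart_homog hs) eqf mulrA -(chart_homog hr).
by move=> /eqP; rewrite eqr_div ?chart_neq0.
Qed.

End Chart.

(** * Local regularity of the Euler coefficients *)

Section Local.
Context {K : numClosedFieldType} {V : vectType K} {n : nat}.
Local Notation N := (\dim {:V}).
Local Notation S := {mpoly K[N]}.
Variables (omega : {skew_symmetric V}) (X : set (projective_space V)).
Local Notation Y := (affine_cone X).
Hypothesis dimV : N = (2 * n)%N.
Hypothesis omegaP : is_psymplectic omega.
Hypothesis closedX : projective_closed X.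
Hypothesis legX : legendrian omega X.
Hypothesis irrX : irreducible projective_closed X.
Hypothesis norX : normal_variety X.
Context {F : fieldType} (phi : {rmorphism S -> F}).
Hypothesis ker_phi : forall p, phi p = 0 <-> vanishing_ideal Y p.
Hypothesis fracs : forall z, exists x y, phi y != 0 /\ z = phi x / phi y.
Variables (f : 'I_n -> S) (e : 'I_n -> nat).
Hypothesis homf : forall i, f i \is (e i).-homog.
Hypothesis genf : homogeneous_ideal X = ideal_generated_by f.

Variables (l : 'I_N) (v : V).
Hypotheses (Yv : Y v) (vl : vcoord v l = 1).

Local Notation ham := (hamiltonian_fields omega f).
Local Notation J := (jacobian f).
Local Notation psi := (chart phi l).
Local Notation loc := (in_local phi l v).

Lemma chart_l0 : phi 'X_l != 0.
Proof.
by apply/eqP => /ker_phi /(_ v Yv) /eqP; rewrite mevalXU vl oner_eq0.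
Qed.

Lemma chart_ham_row_free : row_free (map_mx psi ham).
Proof.
apply: inj_row_free => u u0.
have x0 i : phi 'X_l ^+ (e i).-1 != 0 by rewrite expf_neq0 ?chart_l0.
have : (\row_i (u 0 i / phi 'X_l ^+ (e i).-1)) *m map_mx phi ham = 0.
  rewrite -[RHS]u0; apply/rowP => j.
  rewrite [LHS]mxE [RHS]mxE; apply: eq_bigr => i _.
  rewrite [map_mx phi _ _ _]mxE [map_mx psi _ _ _]mxE.
  rewrite (chart_homog chart_l0 (ham_homog omega homf i j)).
  by rewrite [(\row__ _) _ _]mxE mulrA divfK.
have free := ham_row_free dimV omegaP closedX legX irrX ker_phi fracs genf.
rewrite -[RHS](mul0mx _ (map_mx phi ham)) => /(row_free_inj free) /rowP u0'.
apply/rowP => i; have := u0' i; rewrite !mxE => /eqP.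
by rewrite mulf_eq0 invr_eq0 (negPf (x0 i)) orbF => /eqP.
Qed.

Variable b : 'rV[F]_n.
Hypothesis eulerb : \row_j psi 'X_j = b *m map_mx psi ham.

Lemma coefficient_cramer (R : 'M[S]_(N, n)) i :
  b 0 i * psi (\det (ham *m R)) =
  psi (((\row_j 'X_j) *m R *m \adj (ham *m R)) 0 i).
Proof.
have : map_mx psi (\row_j 'X_j *m R) = b *m map_mx psi (ham *m R).
  rewrite (map_mxM psi _ R) (map_mxM psi ham R) mulmxA -eulerb; congr (_ *m _).
  by apply/rowP => j; rewrite !mxE.
set A := ham *m R => eA.
have : map_mx psi ((\row_j 'X_j) *m R *m \adj A) = psi (\det A) *: b.
  by rewrite map_mxM eA map_mx_adj -mulmxA mul_mx_adj det_map_mx mul_mx_scalar.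
by move=> /rowP /(_ i); rewrite [LHS]mxE [RHS]mxE mulrC => <-.
Qed.

Lemma coefficient_fraction i : in_fractions phi l (b 0 i).
Proof.
have full : row_full (map_mx psi ham)^T.
  by rewrite /row_full mxrank_tr; exact: chart_ham_row_free.
pose R : 'M[S]_(N, n) := (rowsub (fullrankfun full) 1%:M)^T.
exists (((\row_j 'X_j) *m R *m \adj (ham *m R)) 0 i), (\det (ham *m R)).
have d0 : psi (\det (ham *m R)) != 0.
  rewrite -det_map_mx (map_mxM psi ham R) -det_tr trmx_mul -map_trmx trmxK.
  have -> : map_mx psi (rowsub (fullrankfun full) 1%:M) = rowsub (fullrankfun full) 1%:M.
    by rewrite map_mxsub map_mx1.
  rewrite -rowsubE -unitfE -[_ \is a _]/(_ \in unitmx).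
  by rewrite -row_full_unit; apply: fullrowsub_full.
by split=> //; apply: (canRL (mulfK d0)); exact: coefficient_cramer.
Qed.

(** Suppose that the coefficient [b 0 i] is not in the local ring.  A maximal
    ideal of denominators [P] of a multiple [s * b 0 i] is prime.  Either
    [s * b 0 i] maps [P] into itself, and then is integral; or, up to factors
    outside [P], one element [p0] generates [P] on the cone.  In the latter
    case the differentials of the elements of [P] are spanned by those of [p0],
    of [x_l] and of the equations; their rank is at least the codimension of
    [P], so the Jacobian matrix still has rank [n] modulo [P].  But then
    Cramer's rule gives a denominator of [b 0 i] outside [P]. *)
Lemma coefficient_local i : loc (b 0 i).
Proof.
have l0 := chart_l0; set z := b 0 i; apply: contrapT => nz.
have locD x y : loc x -> loc y -> loc (x + y) by apply: (in_localD ker_phi).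
have locM x y : loc x -> loc y -> loc (x * y) by apply: in_localM.
have nz0 p : p.@[vcoord v] != 0 -> psi p != 0 by apply: (chart_neq0 ker_phi).
pose den s p := loc (psi (p * s) * z).
have iden s : ideal (den s).
  split=> [|p q dp dq|a p dp]; rewrite /den.
  - by rewrite mul0r rmorph0 mul0r; apply: in_local0.
  - by rewrite mulrDl rmorphD mulrDl; apply: locD.
  - rewrite -mulrA rmorphM -mulrA; apply: locM => //; exact: in_local_psi.
pose Phi (I : S -> Prop) := exists s, ~ loc (psi s * z) /\ forall p, I p <-> den s p.
have [||P [[s [ns Pden]] _ Pmax]] := @noetherian_max S Phi (den 1) (@noetherian_mpoly K N).
- move=> I [s [_ Is]]; have [D0 DD DM] := iden s; split.
  + exact/Is.
  + by move=> x y /Is dx /Is dy; apply/Is/DD.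
  + by move=> a x /Is dx; apply/Is/DM.
- by exists 1; rewrite rmorph1 mul1r.
set z' := psi s * z in ns.
have PE p : P p <-> loc (psi p * z') by rewrite Pden /den /z' rmorphM mulrA.
have iP : ideal P.
  have [D0 DD DM] := iden s; split; first exact/Pden.
    by move=> x y /Pden dx /Pden dy; apply/Pden/DD.
  by move=> a x /Pden dx; apply/Pden/DM.
have nP1 : ~ P 1 by move=> /PE; rewrite rmorph1 mul1r.
have primeP : prime_ideal P.
  split=> // x y Pxy; apply: contrapT => /not_orP [nPx nPy]; apply: nPy.
  apply: (Pmax (den (x * s))).
  - by exists (x * s); split=> //; rewrite rmorphM -mulrA; move/PE: nPx.
  - move=> w /PE Pw; rewrite /den mulrCA rmorphM -mulrA rmorphM -mulrA.
    by apply: locM => //; exact: in_local_psi.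
  - by rewrite /den mulrA [y * x]mulrC; apply/Pden.
have kerP p : psi p = 0 -> P p.
  by move=> p0; apply/PE; rewrite p0 mul0r; apply: in_local0.
have Pv p : P p -> p.@[vcoord v] = 0.
  move=> /PE Pp; apply/eqP; apply: contrapT => /negP pv; apply: ns.
  rewrite -[z'](mulKf (nz0 _ pv)); apply: locM => //; exact: in_local_inv.
have [u [w [w0 zuw]]] : in_fractions phi l z by apply: coefficient_fraction.
have Pw : P w.
  by apply/PE; rewrite /z' mulrCA zuw [psi w * _]mulrC divfK // -rmorphM; apply: in_local_psi.
have [case1|case2] := pselect (forall p, P p ->
    exists p' q, [/\ P p', q.@[vcoord v] != 0 & psi p * z' = psi p' / psi q]).
  (* Multiplication by [z'] is given on generators of [P] by a matrix over the
     local ring, so [z'] is integral. *)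
  have [c cP Pc] := noetherian_mpoly iP.
  have /choice [t tP] (j : 'I_(size c)) : exists tq : ('I_(size c) -> S) * S,
      tq.2.@[vcoord v] != 0 /\
      psi c`_j * z' = psi (\sum_k tq.1 k * c`_k) / psi tq.2.
    have [p' [q [/Pc /ideal_spanP [t ->] q0 eq]]] := case1 _ (cP _ (mem_nth 0 (ltn_ord j))).
    by exists (t, q).
  apply: ns; pose g := \row_(j < size c) psi c`_j.
  apply: (@local_integral _ _ _ _ _ ker_phi l l0 v Yv vl _
    (\matrix_(k, j) (psi ((t j).1 k) / psi (t j).2)) g) => //.
  - exists (s * u), w; split=> //.
    by rewrite /z' zuw rmorphM mulrA.
  - move=> k j; rewrite mxE; apply: locM; first exact: in_local_psi.
    by apply: in_local_inv; case: (tP j).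
  - apply: contraNneq w0 => g0; have /ideal_spanP [a ->] := Pc _ Pw.
    rewrite rmorph_sum big1 // => j _; rewrite rmorphM.
    by move/rowP: g0 => /(_ j); rewrite !mxE => ->; rewrite mulr0.
  - apply/rowP => j; rewrite !mxE [RHS]mulrC; have [_ ->] := tP j.
    rewrite rmorph_sum mulr_suml; apply: eq_bigr => k _.
    by rewrite !mxE rmorphM mulrCA mulrA.
(* The numerator [u0] of [p0 * z'] is not in [P]; cross-multiplication writes a
   multiple of any element of [P] as a multiple of [p0]. *)
move/existsNP: case2 => [p0 /not_implyP [Pp0 np0]].
have [u0 [q0 [q0v eu0]]] := (PE p0).1 Pp0.
have nPu0 : ~ P u0 by move=> Pu0; apply: np0; exists u0, q0.
have princ p : P p -> exists r t, [/\ ~ P r & psi (p * r - p0 * t) = 0].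
  move=> /PE [u' [q' [q'v eu']]]; exists (u0 * q'), (u' * q0); split.
    case: (primeP) => _ _ PM /PM [//|/Pv q'0].
    by rewrite q'0 eqxx in q'v.
  have e1 : psi p * (psi u0 / psi q0) = psi p0 * (psi u' / psi q').
    by rewrite -eu0 -eu' mulrCA.
  apply/eqP; rewrite rmorphB !rmorphM subr_eq0; apply/eqP.
  have := congr1 ( *%R (psi q0 * psi q')) e1.
  have -> : psi q0 * psi q' * (psi p * (psi u0 / psi q0)) = psi p * (psi u0 * psi q').
    by field; apply: nz0.
  have -> : psi q0 * psi q' * (psi p0 * (psi u' / psi q')) = psi p0 * (psi u' * psi q0).
    by field; apply: nz0.
  by [].
have [F' [chi [kerchi fracs']]] := residue_field primeP.
have chi_f j : chi (f j) = 0.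
  apply/kerchi/kerP/(chart_eq0 ker_phi l0)/(ker_gen ker_phi genf).
  exact: gen_mem.
have chi_l : chi 'X_l = 1.
  apply/eqP; rewrite -subr_eq0 -(rmorph1 chi) -rmorphB; apply/eqP/kerchi/kerP.
  by rewrite rmorphB rmorph1 chart_l // subrr.
pose grad p : 'cV[F']_N := \col_j chi p^`M(j).
pose M : 'M[F']_(N, n + (1 + 1)) :=
  row_mx (map_mx chi J) (row_mx (delta_mx l 0) (grad p0)).
have tan (y : 'rV[F']_N) : y *m M = 0 -> tangent chi (y 0).
  rewrite !mul_mx_row => y0 p /kerchi Pp.
  have [yJ [yl yp0]] : y *m map_mx chi J = 0 /\ y *m delta_mx l 0 = 0 :> 'M_1 /\ y *m grad p0 = 0.
    have := congr1 lsubmx y0; rewrite row_mxKl linear0 => ->.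
    have y1 := congr1 rsubmx y0; rewrite row_mxKr linear0 in y1.
    have := congr1 lsubmx y1; rewrite row_mxKl linear0 => ->.
    by have := congr1 rsubmx y1; rewrite row_mxKr linear0 => ->.
  have yl0 : deriv_along chi (y 0) 'X_l = 0.
    by rewrite deriv_alongX; have /matrixP /(_ 0 0) := yl; rewrite -colE !mxE.
  have dp0 : deriv_along chi (y 0) p0 = 0.
    have /matrixP /(_ 0 0) := yp0; rewrite !mxE => <-.
    by apply: eq_bigr => j _; rewrite !mxE mulrC.
  have dker g : psi g = 0 -> deriv_along chi (y 0) g = 0.
    move=> g0; have hg : phi (homogenize l (msize g) g) = 0.
      by rewrite (phi_homogenize l0) // g0 mulr0.
    have tJ := (tangent_jacobian (y 0) chi_f).1.
    have <- : deriv_along chi (y 0) (homogenize l (msize g) g) = deriv_along chi (y 0) g.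
      rewrite [in RHS](@components _ _ g (msize g).+1) // !raddf_sum.
      apply: eq_bigr => j _; rewrite [LHS]deriv_alongM rmorphXn chi_l expr1n mulr1.
      suff -> : deriv_along chi (y 0) ('X_l ^+ (msize g - j)) = 0 by rewrite mulr0 addr0.
      elim: (msize g - j)%N => [|m IH]; first by rewrite expr0 -mpolyC1 deriv_alongC.
      by rewrite exprS deriv_alongM yl0 IH mul0r mulr0 addr0.
    apply: tJ; last exact/(ker_gen ker_phi genf).
    by rewrite -[RHS]yJ; congr (_ *m _); apply/rowP => j; rewrite mxE.
  have [r [t [nPr /dker]]] := princ p Pp.
  have chip0 : chi p0 = 0 by apply/kerchi.
  have chip : chi p = 0 by apply/kerchi.
  rewrite raddfB /= !deriv_alongM dp0 chip0 chip !mul0r !addr0 subr0 => /eqP.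
  rewrite mulf_eq0 => /orP [/eqP //|/eqP /kerchi //].
have dims := tangent_dim_le tan.
have drop1 : (tdeg psi < tdeg phi)%N.
  apply: (@tdeg_drop _ _ _ _ phi psi ('X_l - 1)).
  - by move=> p; apply: chart_eq0.
  - by rewrite rmorphB rmorph1 chart_l // subrr.
  - apply/eqP => /ker_phi /(_ 0 (or_introl (erefl _))) /eqP.
    rewrite rmorphB rmorph1 /= mevalXU /vcoord linear0 add0r.
    by rewrite oppr_eq0 oner_eq0.
have drop2 : (tdeg chi < tdeg psi)%N.
  by apply: (@tdeg_drop _ _ _ _ psi chi w) => // [p /kerP /kerchi|]; last exact/kerchi.
have rankJ : row_free (map_mx chi ham).
  have tphi := generic_tdeg dimV omegaP closedX legX irrX ker_phi fracs genf.
  rewrite /row_free rank_ham // eqn_leq rank_leq_col /=.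
  have le : (\rank M <= \rank (map_mx chi J) + (1 + 1))%N.
    have rowle a c d (A : 'M[F']_(a, c)) (B : 'M[F']_(a, d)) :
        (\rank (row_mx A B) <= \rank A + \rank B)%N.
      by rewrite -mxrank_tr tr_row_mx -[\rank A]mxrank_tr -[\rank B]mxrank_tr -addsmxE mxrank_adds_leqif.
    apply: leq_trans (rowle _ _ _ _ _) _; rewrite leq_add2l.
    by apply: leq_trans (rowle _ _ _ _ _) _; rewrite leq_add // rank_leq_col.
  have := leq_trans dims (leq_add le (leqnn _)); rewrite -addnA.
  rewrite tphi in drop1 => h.
  have t2 : (1 + 1 + tdeg chi <= n)%N := leq_ltn_trans drop2 drop1.
  rewrite -(leq_add2r n); apply: leq_trans (leq_trans h (leq_add (leqnn _) t2)).
  by rewrite addnn -mul2n -dimV.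
have [A hamA] := row_freeP rankJ.
have [q [R [q_0 eR]]] := clear_denominators A fracs'.
have Pdet : P (\det (ham *m R)).
  apply/PE; rewrite /z' mulrCA [psi _ * z]mulrC coefficient_cramer -rmorphM.
  exact: in_local_psi.
move/kerchi: Pdet; rewrite -det_map_mx (map_mxM chi ham R) eR -scalemxAr hamA.
by move/eqP; rewrite detZ det1 mulr1 expf_eq0 (negPf q_0) andbF.
Qed.

End Local.

(** * Forms of nonpositive degree that are regular everywhere *)

Lemma component_mul (K : numClosedFieldType) N (p q : {mpoly K[N]}) d d' :
  q \is d'.-homog -> component (d + d') (p * q) = component d p * q.
Proof.
move=> hq; have sp : (msize p <= maxn (msize p) d.+1)%N by apply: leq_maxl.
have lt : (d < maxn (msize p) d.+1)%N by rewrite leq_max ltnSn orbT.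
rewrite [in LHS](components sp) mulr_suml raddf_sum (bigD1 (Ordinal lt)) //=.
rewrite big1 => [|i ne].
  by rewrite addr0 pihomog_dE // dhomogM // pihomogP.
rewrite (@pihomog_ne0 _ _ _ (i + d')%N) //; first by rewrite eqn_add2r.
by rewrite dhomogM // pihomogP.
Qed.

Section Global.
Context {K : numClosedFieldType} {V : vectType K}.
Local Notation N := (\dim {:V}).
Local Notation S := {mpoly K[N]}.
Variable X : set (projective_space V).
Local Notation Y := (affine_cone X).
Hypothesis closedX : projective_closed X.
Hypothesis irrX : irreducible projective_closed X.
Context {F : fieldType} (phi : {rmorphism S -> F}).
Hypothesis ker_phi : forall p, phi p = 0 <-> vanishing_ideal Y p.
Variables (alpha : F) (k : nat).
Hypothesis local_alpha : forall l v, Y v -> vcoord v l = 1 ->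
  in_local phi l v (phi 'X_l ^+ k * alpha).

Let regular q := exists t, phi q * alpha = phi t.

Let ideal_regular : ideal regular.
Proof.
split=> [|p q [s ps] [t qt]|a p [s ps]].
- by exists 0; rewrite !rmorph0 mul0r.
- by exists (s + t); rewrite !rmorphD mulrDl ps qt.
- by exists (a * s); rewrite !rmorphM -mulrA ps.
Qed.

Let phi_neq0 q v : Y v -> q.@[vcoord v] != 0 -> phi q != 0.
Proof. by move=> Yv; apply: contra_neq => /ker_phi; apply. Qed.

(** Homogenizing a fraction in a chart absorbs the power of the coordinate that
    brings [alpha] to degree zero. *)
Let homogeneous_denominator l v : Y v -> vcoord v l = 1 -> exists q t d,
  [/\ q \is (d + k).-homog, t \is d.-homog, q.@[vcoord v] != 0 & phi q * alpha = phi t].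
Proof.
move=> Yv vl; have l0 : phi 'X_l != 0.
  by apply: (phi_neq0 Yv); rewrite mevalXU vl oner_neq0.
have [p [q [q0 eq]]] := local_alpha Yv vl.
pose d := maxn (msize p) (msize q).
have sp : (msize p <= d.+1)%N by rewrite (leq_trans (leq_maxl _ _) (leqnSn _)).
have sq : (msize q <= d.+1)%N by rewrite (leq_trans (leq_maxr _ _) (leqnSn _)).
have hl : ('X_l ^+ k : S) \is (1 * k)%N.-homog by apply: dhomogMn; rewrite dhomogX /= mdeg1.
exists (homogenize l d q * 'X_l ^+ k), (homogenize l d p), d; split.
- by rewrite -[k in (_ + k)%N]mul1n; apply: dhomogM => //; apply: homogenize_homog.
- exact: homogenize_homog.
- rewrite -[_.@[_]]/(meval (vcoord v) _) rmorphM rmorphXn homogenize_dehom //=.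
    by rewrite mevalXU vl expr1n mulr1.
  by rewrite mevalXU.
- rewrite rmorphM rmorphXn -mulrA eq !(phi_homogenize l0) //.
  by rewrite -mulrA; congr (_ * _); rewrite mulrCA divff ?mulr1 // (chart_neq0 ker_phi l0 Yv vl).
Qed.

(** The denominators of [alpha] have no common zero on the cone other than the
    origin, so they contain a power of each coordinate. *)
Let regular_power j : exists m, regular ('X_j ^+ m).
Proof.
apply: contrapT => no.
have [|x y [m ->] [m' ->]|x xr [m xm]|P [pP rP PM]] := @prime_avoiding S regular
    (fun q => exists m, q = 'X_j ^+ m) (@noetherian_mpoly K N) ideal_regular.
- by exists 0%N; rewrite expr0.
- by exists (m + m')%N; rewrite exprD.
- by apply: no; exists m; rewrite -xm.
have [F' [chi [ker _]]] := residue_field pP.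
have [|w zw wj] := @zeros_point _ _ _ chi 'X_j.
  by apply/eqP => /ker /PM; apply; exists 1%N; rewrite expr1.
rewrite mevalXU in wj.
have Yw : Y w.
  rewrite -(cone_zeros closedX irrX ker_phi) => p p0; apply: zw; apply/ker/rP.
  by exists 0; rewrite p0 mul0r rmorph0.
pose w1 := (vcoord w j)^-1 *: w.
have w1j : vcoord w1 j = 1 by rewrite vcoordZ mulVf.
have [q [t [d [hq _ qw1 qt]]]] := homogeneous_denominator (cone_scale _ Yw) w1j.
move: qw1; rewrite (homog_vcoordZ _ _ hq) (zw q) ?mulr0 ?eqxx //.
by apply/ker/rP; exists t.
Qed.

Let regular_homog : exists T, forall d q, (T <= d)%N -> q \is d.-homog -> regular q.
Proof.
have /choice [m mP] := regular_power.
have [R0 RD RM] := ideal_regular.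
exists (\sum_j m j).+1 => d q Td /dhomogP hq; rewrite [q]mpolyE big_seq.
apply: ideal_sum => // u /hq eu; rewrite -mul_mpolyC; apply: (RM).
have [j mj] : exists j, (m j <= u j)%N.
  apply: contrapT => no; move: Td; rewrite ltnNge -eu /= mdegE => /negP; apply.
  apply: leq_sum => j _; rewrite leqNgt; apply/negP => lt; apply: no.
  by exists j; apply: ltnW.
rewrite mpolyXE_id (bigD1 j) //= mulrC -(subnK mj) exprD mulrA.
exact: RM.
Qed.

Let alpha_fraction : exists u w d,
  [/\ u \is d.-homog, w \is (d + k).-homog, phi w != 0 & phi w * alpha = phi u].
Proof.
have [j Xj] := coordinate_neq0 irrX ker_phi.
have [[L XL] _] := irrX; have [v v0 eL] := line_gen L.
have Yv : Y v by right; exists L => //; rewrite eL memv_line.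
have [l vl] : exists l, vcoord v l != 0.
  apply: contrapT => no; move/eqP: v0; apply; apply: vcoord_inj => i.
  rewrite [RHS]linear0; apply/eqP; apply: contrapT => /negP nz.
  by apply: no; exists i.
have wl : vcoord ((vcoord v l)^-1 *: v) l = 1 by rewrite vcoordZ mulVf.
have [q [t [d [hq ht qw qt]]]] := homogeneous_denominator (cone_scale _ Yv) wl.
by exists t, q, d; split=> //; apply: phi_neq0 qw; apply: cone_scale.
Qed.

(** A section of a line bundle of nonpositive degree: multiplied by a form of
    degree [k], it acts linearly on the finite-dimensional space of the forms of
    a large degree on the cone, hence is algebraic over [K]. *)
Lemma global_section_constant p :
  p \is k.-homog -> exists c, phi p * alpha = phi c%:MP.
Proof.
move=> hp; have [T TP] := regular_homog.
have [u [w [d [hu hw w0 uw]]]] := alpha_fraction.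
pose I := 'X_{1..N < T.+1} : finType.
have step (m : I) : exists t, mdeg m = T ->
    t \is T.-homog /\ phi p * alpha * phi 'X_[m] = phi t.
  have [em|ne] := eqVneq (mdeg m) T; last by exists 0 => /eqP; rewrite (negPf ne).
  have hm : ('X_[m] : S) \is T.-homog by rewrite dhomogX /= em.
  have [t et] := TP _ _ (leq_addr k T) (dhomogM hm hp).
  exists (component T t) => _; split; first exact: pihomogP.
  have ker0 : phi ('X_[m] * p * u - t * w) = 0.
    by rewrite rmorphB !rmorphM -uw -et !rmorphM; ring.
  have := ker_component ker_phi (T + (d + k)) ker0.
  rewrite raddfB /= (component_mul t T hw) pihomog_dE; last first.
    by rewrite addnA addnAC; apply: dhomogM => //; apply: dhomogM.
  rewrite rmorphB !rmorphM -uw => /eqP; rewrite subr_eq0 => /eqP e1.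
  by apply: (mulIf w0); rewrite -e1; ring.
have /choice [t tP] := step.
pose n := #|I|; pose ev (j : 'I_n) : I := enum_val j.
pose c := \row_(j < n) if mdeg (ev j) == T then phi 'X_[ev j] else 0.
pose U : 'M[K]_n := \matrix_(i, j)
  if (mdeg (ev j) == T) && (mdeg (ev i) == T) then (t (ev j))@_(ev i) else 0.
have [j Xj] := coordinate_neq0 irrX ker_phi.
have c0 : c != 0.
  have degm : mdeg (U_(j) *+ T)%MM = T by rewrite mdegMn mdeg1 mul1n.
  have lt : (mdeg (U_(j) *+ T)%MM < T.+1)%N by rewrite degm.
  pose m : I := BMultinom lt.
  apply/eqP => /rowP /(_ (enum_rank m)); rewrite !mxE /ev enum_rankK /= degm eqxx.
  by rewrite /= -mpolyXn rmorphXn => /eqP; rewrite expf_eq0 (negPf Xj) andbF.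
have cU : c *m map_mx (phi \o @mpolyC N K) U = (phi p * alpha) *: c.
  apply/rowP => i; rewrite !mxE.
  have [ei|ne] := eqVneq (mdeg (ev i)) T; last first.
    rewrite mulr0 big1 // => j' _; rewrite !mxE (negPf ne) /=.
    by rewrite mpolyC0 rmorph0 mulr0.
  have [ht ->] := tP (ev i) ei.
  have st : (msize (t (ev i)) <= T.+1)%N.
    rewrite msizeE; apply/bigmax_leqP_seq => m mt _.
    by rewrite (dhomog_mf ht mt).
  rewrite -[in RHS](pihomog_dE ht) (pihomogwE _ _ st) rmorph_sum /=.
  rewrite [RHS]big_mkcond (reindex ev) /=; last first.
    by apply: onW_bij; apply: enum_val_bij.
  apply: eq_bigr => j' _; rewrite !mxE ei eqxx /=.
  by case: ifP => _; rewrite ?mul0r // -mul_mpolyC rmorphM mulrC.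
have : root (char_poly (map_mx (phi \o @mpolyC N K) U)) (phi p * alpha).
  by rewrite -eigenvalue_root_char; apply/eigenvalueP; exists c.
rewrite -map_char_poly => /closed_field_root [|a ->]; last by exists a.
exact/monic_neq0/char_poly_monic.
Qed.

End Global.

(** * The Euler vector field forces linearity *)

Section Finale.
Context {K : numClosedFieldType} {V : vectType K} {n : nat}.
Local Notation N := (\dim {:V}).
Local Notation S := {mpoly K[N]}.
Variables (omega : {skew_symmetric V}) (X : set (projective_space V)).
Local Notation Y := (affine_cone X).
Hypothesis dimV : N = (2 * n)%N.
Hypothesis omegaP : is_psymplectic omega.
Hypothesis closedX : projective_closed X.
Hypothesis legX : legendrian omega X.
Hypothesis irrX : irreducible projective_closed X.
Hypothesis norX : normal_variety X.
Context {F : fieldType} (phi : {rmorphism S -> F}).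
Hypothesis ker_phi : forall p, phi p = 0 <-> vanishing_ideal Y p.
Hypothesis fracs : forall z, exists x y, phi y != 0 /\ z = phi x / phi y.
Variables (f : 'I_n -> S) (e : 'I_n -> nat).
Hypothesis homf : forall i, f i \is (e i).-homog.
Hypothesis genf : homogeneous_ideal X = ideal_generated_by f.
Variable a : 'rV[F]_n.
Hypothesis eulera : \row_j phi 'X_j = a *m map_mx phi (hamiltonian_fields omega f).

Local Notation ham := (hamiltonian_fields omega f).
Local Notation J := (jacobian f).

Lemma degree_gt0 i : (0 < e i)%N.
Proof.
rewrite lt0n; apply/eqP => ei.
have free := ham_row_free dimV omegaP closedX legX irrX ker_phi fracs genf.
have df j : (f i)^`M(j) = 0.
  have h0 : f i \is 0.-homog by have := homf i; rewrite ei.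
  by rewrite (homog0_const h0) mderivC.
have r0 : delta_mx 0 i *m map_mx phi ham = 0 :> 'rV_N.
  rewrite -rowE; apply/rowP => j; rewrite !mxE big1 ?rmorph0 // => k _.
  by rewrite !mxE df mul0r.
have /rowP /(_ i) := row_free_inj free (etrans r0 (esym (mul0mx 1%N (map_mx phi ham)))).
by rewrite !mxE !eqxx => /eqP; rewrite oner_eq0.
Qed.

(** Multiplied by a power of a coordinate, [a 0 i] becomes a coefficient of the
    Euler vector field of a chart, hence is regular there; and its degree
    [2 - e i] is at most 0. *)
Lemma coefficient_constant i p : (1 < e i)%N -> p \is (e i - 2).-homog ->
  exists c, phi p * a 0 i = phi c%:MP.
Proof.
move=> ei; apply: (global_section_constant closedX irrX ker_phi) => l v Yv vl.
have l0 := chart_l0 ker_phi Yv vl.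
pose b := \row_i (a 0 i * phi 'X_l ^+ (e i).-1 / phi 'X_l).
have eulerb : \row_j chart phi l 'X_j = b *m map_mx (chart phi l) ham.
  apply/rowP => j; rewrite [LHS]mxE chartX.
  have /rowP /(_ j) := eulera; rewrite [LHS]mxE => ->.
  rewrite [X in X / _]mxE [RHS]mxE mulr_suml; apply: eq_bigr => k _.
  rewrite [map_mx phi _ _ _]mxE [map_mx (chart _ _) _ _ _]mxE.
  rewrite (chart_homog l0 (ham_homog omega homf k j)) [b _ _]mxE.
  by rewrite mulrA mulrAC.
have := coefficient_local dimV omegaP closedX legX irrX norX ker_phi fracs homf genf Yv vl eulerb i.
rewrite mxE; have -> : (e i).-1 = (e i - 2).+1 by rewrite subn2; case: (e i) ei => [|[]].
by rewrite exprSr mulrA mulfK // mulrC.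
Qed.

(** Multiplied by the monomials of degree [e i - 2], a nonzero coefficient of
    negative degree becomes constant; the coordinates are then proportional, and
    the variety is a single point. *)
Lemma line_linear i : (2 < e i)%N -> a 0 i != 0 -> linear_subspace X.
Proof.
move=> ei ai; have [j Xj] := coordinate_neq0 irrX ker_phi.
have ek : (e i - 2)%N = (e i - 3).+1 by case: (e i) ei => [|[|[|m]]] // _; rewrite !subSS !subn0.
have hX k m : ('X_k ^+ m : S) \is m.-homog.
  by rewrite -[X in X.-homog]mul1n; apply: dhomogMn; rewrite dhomogX /= mdeg1.
have /choice [c cP] k : exists c, phi ('X_j ^+ (e i - 3) * 'X_k) * a 0 i = phi c%:MP.
  apply: coefficient_constant; first exact: ltnW.
  have := dhomogM (hX j (e i - 3)%N) (hX k 1%N).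
  by rewrite expr1 addn1 -ek.
have cj0 : c j != 0.
  rewrite -(rmorph_mpolyC_eq0 phi) -cP rmorphM rmorphXn -exprSr.
  by rewrite mulf_neq0 // expf_neq0.
have prop v k : Y v -> vcoord v k = (vcoord v j / c j) * c k.
  move=> Yv; have /ker_phi /(_ v Yv) : phi ((c j)%:MP * 'X_k - (c k)%:MP * 'X_j) = 0.
    rewrite rmorphB !rmorphM -!cP; rewrite !rmorphM; ring.
  rewrite rmorphB !rmorphM /= !mevalC !mevalXU => /eqP; rewrite subr_eq0 => /eqP eq.
  by apply: (mulfI cj0); rewrite eq; field.
pose w := of_coord c.
have YW v : Y v -> exists t, v = t *: w.
  move=> Yv; exists (vcoord v j / c j); apply: vcoord_inj => k.
  by rewrite vcoordZ of_coordK; exact: prop.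
exists <[w]>%VS; apply/seteqP; split=> L /=.
  move=> XL; apply/subvP => v vL; apply/vlineP; apply: YW.
  by right; exists L.
move=> Lw; have [[L0 XL0] _] := irrX; have [u u0 eL0] := line_gen L0.
have Yu : Y u by right; exists L0; rewrite ?eL0 ?memv_line.
have [v v0 eL] := line_gen L.
have [t et] := YW u Yu; have /vlineP [s es] : v \in <[w]>%VS.
  by apply: (subvP Lw); rewrite eL memv_line.
have t0 : t != 0 by apply: contraNneq u0 => t0; rewrite et t0 scale0r.
apply: (cone_line (v := v)) => //.
have -> : v = (s / t) *: u by rewrite et scalerA divfK.
exact: cone_scale.
Qed.

Section Quadrics.
Hypothesis a_cubic : forall i, (2 < e i)%N -> a 0 i = 0.

Variable W : {vspace V}.
Hypothesis WP : forall v, v \in W <-> forall i, e i = 1%N -> (f i).@[vcoord v] = 0.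

Let quad := [pred i | e i == 2].

(** When only linear and quadratic forms contribute to the Euler vector field,
    [omega] restricted to the span [W] of the cone is the polar form of a
    quadratic form: symmetric as well as alternating, so zero. *)
Lemma span_isotropic : isotropic omega W.
Proof.
have /choice [c cP] i : exists c, e i = 2 -> a 0 i = phi c%:MP.
  have [ei|ne] := eqVneq (e i) 2; last by exists 0 => /eqP; rewrite (negPf ne).
  have [||c] := @coefficient_constant i 1; first by rewrite ei.
    by rewrite ei subnn; apply: dhomog1.
  by rewrite rmorph1 mul1r => ac; exists c.
pose B (w y : V) := \sum_(i | quad i) c i *
  \sum_j ((f i)^`M(j)).@[vcoord w] * vcoord y j.
have Bsym w y : B w y = B y w.
  apply: eq_bigr => i /eqP ei; congr (_ * _).
  have lin j u : ((f i)^`M(j)).@[vcoord u] =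
      \sum_k ((f i)^`M(j)^`M(k)).@[fun=> 0] * vcoord u k.
    by apply: homog1_eval; have := mderiv_homog j (homf i); rewrite ei.
  under eq_bigr do rewrite lin mulr_suml.
  under [in RHS]eq_bigr do rewrite lin mulr_suml.
  rewrite exchange_big; apply: eq_bigr => j _; apply: eq_bigr => k _.
  by rewrite mderiv_comm mulrAC.
suff omB w y : w \in W -> y \in W -> omega w y = B w y.
  move=> w y Ww Wy; have /eqP : omega w y = - omega w y.
    by rewrite -omega_skew !omB // Bsym.
  by rewrite -addr_eq0 -mulr2n mulrn_eq0 => /eqP.
move=> Ww Wy.
pose z := form_matrix omega *m (crow y)^T.
pose lam : S := \sum_j (z j 0) *: 'X_j -
  \sum_(i | quad i) c i *: \sum_j vcoord y j *: (f i)^`M(j).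
have lamE x : lam.@[vcoord x] = omega x y - B x y.
  rewrite rmorphB; congr (_ - _).
    rewrite form_matrixE -mulmxA mxE rmorph_sum; apply: eq_bigr => j _.
    by rewrite /= mevalZ mevalXU mulrC !mxE.
  rewrite rmorph_sum; apply: eq_bigr => i _; rewrite /= mevalZ; congr (_ * _).
  by rewrite rmorph_sum; apply: eq_bigr => j _; rewrite /= mevalZ mulrC.
have lam0 : phi lam = 0.
  have phiZ b p : phi (b *: p) = phi b%:MP * phi p by rewrite -mul_mpolyC rmorphM.
  apply/eqP; rewrite rmorphB subr_eq0; apply/eqP.
  have zham : map_mx phi ham *m map_mx (phi \o @mpolyC N K) z =
      (map_mx phi J)^T *m map_mx (phi \o @mpolyC N K) (crow y)^T.
    rewrite map_ham -mulmxA -map_mxM mulmxA mulVmx ?mul1mx //.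
    exact: form_matrix_unit.
  transitivity ((a *m (map_mx phi ham *m map_mx (phi \o @mpolyC N K) z)) 0 0).
    rewrite mulmxA -eulera mxE rmorph_sum; apply: eq_bigr => j _.
    by rewrite phiZ !mxE mulrC.
  rewrite zham mxE rmorph_sum [RHS]big_mkcond; apply: eq_bigr => i _.
  have -> : ((map_mx phi J)^T *m map_mx (phi \o @mpolyC N K) (crow y)^T) i 0 =
      phi (\sum_j vcoord y j *: (f i)^`M(j)).
    rewrite mxE rmorph_sum; apply: eq_bigr => j _.
    by rewrite phiZ !mxE mulrC.
  have := degree_gt0 i; case: ifP => [/eqP ei _|ne].
    by rewrite phiZ cP.
  rewrite leq_eqVlt => /predU1P [/esym e1|].
    suff -> : \sum_j vcoord y j *: (f i)^`M(j) = 0 by rewrite rmorph0 mulr0.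
    have hf : f i \is 1.-homog by have := homf i; rewrite e1.
    have -> : \sum_j vcoord y j *: (f i)^`M(j) = ((f i).@[vcoord y])%:MP.
      rewrite homog1_eval // rmorph_sum; apply: eq_bigr => j _.
      by rewrite (homog1_deriv j hf) mevalC -mul_mpolyC -mpolyCM mulrC.
    by rewrite ((WP y).1 Wy i e1) mpolyC0.
  rewrite leq_eqVlt eq_sym => /predU1P [e2|e3].
    by move: ne; rewrite /= e2 eqxx.
  by rewrite a_cubic ?mul0r.
have hlam : lam \is 1.-homog.
  apply: rpredB; apply: rpred_sum => i; first by move=> _; apply: rpredZ; rewrite dhomogX /= mdeg1.
  move=> /eqP ei; apply/rpredZ/rpred_sum => j _; apply: rpredZ.
  by have := mderiv_homog j (homf i); rewrite ei.
have : lam.@[vcoord w] = 0; last by rewrite lamE => /eqP; rewrite subr_eq0 => /eqP.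
have [b eb] := (ker_gen ker_phi genf lam).1 lam0.
have := congr1 (fun p => (ray (vcoord w) p)`_1) eb.
rewrite (ray_homog _ hlam) coefZ coefXn eqxx mulr1 => ->.
rewrite rmorph_sum coef_sum big1 // => i _.
rewrite rmorphM (ray_homog _ (homf i)) -scalerAr coefZ coefMXn.
have := degree_gt0 i; rewrite leq_eqVlt => /predU1P [/esym e1|->]; last by rewrite mulr0.
by rewrite ((WP w).1 Ww i e1) mul0r.
Qed.

End Quadrics.

(** The span of the cone, cut out by the linear equations. *)
Lemma span_exists :
  exists W : {vspace V}, forall v, v \in W <-> forall i, e i = 1%N -> (f i).@[vcoord v] = 0.
Proof.
have lin i u : e i = 1%N -> (f i).@[vcoord u] =
    \sum_k ((f i)^`M(k)).@[fun=> 0] * vcoord u k.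
  by move=> ei; apply: homog1_eval; have := homf i; rewrite ei.
apply: (vspace_of_set (T := fun v => forall i, e i = 1%N -> (f i).@[vcoord v] = 0)).
  by move=> i ei; rewrite lin // big1 // => k _; rewrite /vcoord linear0 mulr0.
move=> t u v Tu Tv i ei.
have -> : (f i).@[vcoord (t *: u + v)] = t * (f i).@[vcoord u] + (f i).@[vcoord v].
  rewrite !lin // mulr_sumr -big_split; apply: eq_bigr => k _ /=.
  by rewrite /vcoord linearP mulrDr mulrCA.
by rewrite Tu // Tv // mulr0 addr0.
Qed.

(** The span of the cone is isotropic and contains a Lagrangian tangent space;
    it is therefore equal to it, so that the linear equations alone cut out a
    space of dimension [n] and there are no others. *)
Lemma linear_of_euler : linear_subspace X.
Proof.
have [cubic|ncubic] := pselect (forall i, (2 < e i)%N -> a 0 i = 0); last first.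
  move/existsNP: ncubic => [i /not_implyP [ei /eqP ai]].
  exact: line_linear ei ai.
have [W WP] := span_exists; have isoW := span_isotropic cubic WP.
have phi1 : phi 1 != 0 by rewrite rmorph1 oner_neq0.
have [x [T [Yx _ lagT TJ]]] :=
  generic_point closedX legX irrX ker_phi fracs genf phi1.
set Jx := map_mx _ _ in TJ.
pose J1 := \matrix_(j, i) if e i == 1%N then Jx j i else 0.
have J1E v i : (crow v *m J1) 0 i = if e i == 1%N then (f i).@[vcoord v] else 0.
  rewrite mxE; case: eqP => [ei|ne]; last first.
    by rewrite big1 // => j _; rewrite [J1 _ _]mxE; case: eqP ne => // _ _; rewrite mulr0.
  have hf : f i \is 1.-homog by have := homf i; rewrite ei.
  rewrite (homog1_eval _ hf); apply: eq_bigr => j _.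
  rewrite [J1 _ _]mxE ei eqxx [Jx _ _]mxE !mxE mulrC; congr (_ * _).
  by rewrite (homog1_deriv j hf) /= !mevalC.
have WJ1 v : v \in W <-> crow v *m J1 = 0.
  rewrite WP; split=> [fv|v0 i ei].
    by apply/rowP => i; rewrite J1E mxE; case: eqP => // /fv.
  by have /rowP /(_ i) := v0; rewrite J1E ei eqxx mxE.
have TW : (T <= W)%VS.
  apply/subvP => v /TJ vJ; apply/WJ1/rowP => i; rewrite mxE [RHS]mxE.
  case: (eqVneq (e i) 1%N) => ei; last first.
    by rewrite big1 // => j _; rewrite [J1 _ _]mxE (negPf ei) mulr0.
  have /rowP /(_ i) := vJ; rewrite [RHS]mxE => vi; rewrite -[RHS]vi mxE.
  by apply: eq_bigr => j _; rewrite [J1 _ _]mxE ei eqxx.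
have eWT : W = T by case: lagT => _; apply.
have [_ /(half_dim dimV) rJ] := lagrangian_jacobian omegaP TJ lagT.
have rJ1 : \rank J1 = n.
  apply: etrans rJ; apply: (@addnI (\dim T)); rewrite (dim_kernel TJ).
  by rewrite -eWT (dim_kernel WJ1).
have free1 : row_free J1^T by rewrite /row_free mxrank_tr rJ1.
have e1 i : e i = 1%N.
  apply/eqP; apply: contrapT => /negP ne.
  have r0 : delta_mx 0 i *m J1^T = 0 :> 'rV_N.
    by rewrite -rowE; apply/rowP => j; rewrite !mxE (negPf ne).
  have /rowP /(_ i) := row_free_inj free1 (etrans r0 (esym (mul0mx 1%N J1^T))).
  by rewrite !mxE !eqxx => /eqP; rewrite oner_eq0.
have YW v : Y v <-> v \in W.
  rewrite WP -(cone_zeros closedX irrX ker_phi).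
  have kerf := ker_gen ker_phi genf; rewrite (zerosE kerf).
  by split=> fv i; [move=> _; apply: fv|apply/fv/e1].
exists W; apply/seteqP; split=> L /=.
  by move=> XL; apply/subvP => v vL; apply/YW; right; exists L.
move=> LW; have [v v0 eL] := line_gen L.
apply: (cone_line (v := v)) => //; apply/YW/(subvP LW).
by rewrite eL memv_line.
Qed.

End Finale.

Theorem legendrian_linear (K : numClosedFieldType) (n : nat) (V : vectType K)
    (omega : {skew_symmetric V}) (X : set (projective_space V)) :
  \dim {:V} = (2 * n)%N ->
  is_psymplectic omega ->
  projective_closed X ->
  legendrian omega X ->
  irreducible projective_closed X ->
  normal_variety X ->
  complete_intersection n X ->
  linear_subspace X.
Proof.
move=> dimV omegaP closedX legX irrX norX [f [homf genf]].
have [F [phi [ker_phi fracs]]] := residue_field (cone_prime irrX).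
have [e he] := choice homf.
have [a ea] := euler_hamiltonian dimV omegaP closedX legX irrX ker_phi fracs he genf.
exact: (linear_of_euler dimV omegaP closedX legX irrX norX ker_phi fracs he genf ea).
Qed.

Theorem theorem4p9 (R : realType) (n : nat) (V : vectType R[i])
    (omega : {skew_symmetric V}) (X : set (projective_space V)) :
  \dim {:V} = (2 * n)%N ->
  is_psymplectic omega ->
  projective_closed X ->
  legendrian omega X ->
  irreducible projective_closed X ->
  normal_variety X ->
  complete_intersection n X ->
  linear_subspace X.
Proof. exact: legendrian_linear. Qed.
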